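(* Let $M:[0,\infty)\to(0,\infty)$ be a continuous non-decreasing function and let $A$ be the generator of a bounded $C_0$-semigroup $T=(T(t))_{t\ge 0}$ on a Banach space $X$ such that $i\mathbb{R}\subset\rho(A)$ and $\|(is-A)^{-1}\|\leq M(|s|)$ for all $s\in\mathbb{R}$. Then for any $c\in(0,1)$ $$\|T(t)A^{-1}\| = O\left(\frac{1}{M_{\mathrm{log}}^{-1}(ct)}\right),\qquad t\to\infty,$$ where $M_{\mathrm{log}}(s)=M(s)\log(e\vee sM(s))$ for $s\geq 0$.
   Context: Notation: $a\vee b=\max\{a,b\}$; $\rho(A)$ is the resolvent set of $A$. $M_{\mathrm{log}}$ is continuous, non-decreasing, unbounded and strictly increasing for large arguments; $M_{\mathrm{log}}^{-1}$ denotes its (right-continuous right-)inverse, defined for all sufficiently large arguments. *)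

(* Defs.v *)
From Stdlib Require Import Reals Lra.
From Coquelicot Require Import Coquelicot.
Open Scope R_scope.

(** Complex Banach spaces are [CompleteNormedModule C_AbsRing]; [is_linear] is
    Coquelicot's notion of bounded linear map. *)

(** The value is [p_infty] for an unbounded map, so [Rbar_le (op_norm L) (Finite K)]
    really asserts boundedness. *)
Definition op_norm {X Y : NormedModule C_AbsRing} (L : X -> Y) : Rbar :=
  Lub_Rbar (fun r => exists x : X, norm x <= 1 /\ r = norm (L x)).

(** Values of [op_map] outside [op_dom] are irrelevant. *)
Record operator (X : CompleteNormedModule C_AbsRing) := Operator {
  op_dom : X -> Prop;
  op_map : X -> X }.
Arguments Operator {X} op_dom op_map.
Arguments op_dom {X} o x.
Arguments op_map {X} o x.

Definition op_shift {X : CompleteNormedModule C_AbsRing}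
    (l : C) (A : operator X) : operator X :=
  Operator (op_dom A) (fun x => minus (scal (l : C_AbsRing) x) (op_map A x)).

Definition op_bijective {X : CompleteNormedModule C_AbsRing}
    (B : operator X) : Prop :=
  forall y : X, exists! x : X, op_dom B x /\ op_map B x = y.

(** [iota P] is the unique element satisfying [P], when there is one. *)
Definition op_inv {X : CompleteNormedModule C_AbsRing} (B : operator X) : X -> X :=
  fun y => iota (fun x : X => op_dom B x /\ op_map B x = y).

Definition resolvent_set {X : CompleteNormedModule C_AbsRing}
    (A : operator X) (l : C) : Prop :=
  op_bijective (op_shift l A) /\ is_linear (op_inv (op_shift l A)).

(** Only the values [T t] with [0 <= t] matter. *)
Record is_C0_semigroup {X : CompleteNormedModule C_AbsRing} (T : R -> X -> X) : Prop := {
  C0_linear : forall t, 0 <= t -> is_linear (T t);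
  C0_zero : forall x, T 0 x = x;
  C0_plus : forall s t x, 0 <= s -> 0 <= t -> T (s + t) x = T s (T t x);
  C0_cont : forall x, filterlim (fun t => T t x) (at_right 0) (locally x) }.

Definition bounded_semigroup {X : CompleteNormedModule C_AbsRing}
    (T : R -> X -> X) : Prop :=
  exists K : R, forall t, 0 <= t -> Rbar_le (op_norm (T t)) K.

Definition is_generator_value {X : CompleteNormedModule C_AbsRing}
    (T : R -> X -> X) (x y : X) : Prop :=
  filterlim (fun h : R => scal (RtoC (/ h) : C_AbsRing) (minus (T h x) x))
    (at_right 0) (locally y).

Definition is_generator {X : CompleteNormedModule C_AbsRing}
    (A : operator X) (T : R -> X -> X) : Prop :=
  (forall x, op_dom A x <-> exists y, is_generator_value T x y) /\
  (forall x, op_dom A x -> is_generator_value T x (op_map A x)).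

(** Functions on [[0, +oo)] are represented by functions on [R] of which only the
    restriction to [[0, +oo)] is used. *)
Definition continuous_nonneg (f : R -> R) : Prop :=
  forall s, 0 <= s ->
    filterlim f (within (fun u => 0 <= u) (locally s)) (locally (f s)).

Definition nondecreasing_nonneg (f : R -> R) : Prop :=
  forall s u, 0 <= s -> s <= u -> f s <= f u.

Definition Mlog (M : R -> R) (s : R) : R :=
  M s * ln (Rmax (exp 1) (s * M s)).

(** [g] is a right-continuous right-inverse of [f : [0, +oo) -> R], defined for all
    sufficiently large arguments.  For [f = Mlog M] such a [g] exists
    ([Mlog_right_inverse_exists]) and any two of them agree for large arguments
    ([Mlog_right_inverse_unique]). *)
Definition is_rc_right_inverse (f g : R -> R) : Prop :=
  Rbar_locally p_infty (fun tau =>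
    0 <= g tau /\ f (g tau) = tau /\
    filterlim g (at_right tau) (locally (g tau))).

Section MlogInverse.

Variable M : R -> R.
Hypothesis Mpos : forall s, 0 <= s -> 0 < M s.
Hypothesis Mcont : continuous_nonneg M.
Hypothesis Mincr : nondecreasing_nonneg M.

Lemma ln_Rmax_e_ge1 x : 1 <= ln (Rmax (exp 1) x).
Proof.
rewrite <- (ln_exp 1) at 1.
apply ln_le; [apply exp_pos | apply Rmax_l].
Qed.

Lemma Mlog_incr : nondecreasing_nonneg (Mlog M).
Proof.
intros s u Hs Hu. unfold Mlog.
assert (Hu0 : 0 <= u) by lra.
pose proof (Mpos s Hs). pose proof (Mpos u Hu0). pose proof (Mincr s u Hs Hu).
apply Rmult_le_compat; try lra.
- pose proof (ln_Rmax_e_ge1 (s * M s)); lra.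
- apply ln_le.
  + apply Rlt_le_trans with (exp 1); [apply exp_pos | apply Rmax_l].
  + apply Rle_max_compat_l. apply Rmult_le_compat; lra.
Qed.

Lemma Mlog_strict s u : exp 1 / M 0 < s -> s < u -> Mlog M s < Mlog M u.
Proof.
intros Hs Hu.
pose proof (Mpos 0 (Rle_refl 0)) as H0. pose proof (exp_pos 1) as He.
assert (Hs0 : 0 < s).
{ apply Rlt_trans with (2 := Hs). apply Rdiv_lt_0_compat; lra. }
pose proof (Mincr 0 s (Rle_refl 0) (Rlt_le _ _ Hs0)) as Hm.
pose proof (Mincr s u (Rlt_le _ _ Hs0) (Rlt_le _ _ Hu)) as Hm'.
assert (H1 : exp 1 < s * M s).
{ apply Rlt_le_trans with (s * M 0).
  - apply (Rmult_lt_compat_r (M 0)) in Hs; [|lra].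
    replace (exp 1 / M 0 * M 0) with (exp 1) in Hs by (field; lra). exact Hs.
  - apply Rmult_le_compat_l; lra. }
assert (H2 : s * M s < u * M u).
{ apply Rlt_le_trans with (u * M s).
  - apply Rmult_lt_compat_r; lra.
  - apply Rmult_le_compat_l; lra. }
unfold Mlog. rewrite !Rmax_right by lra.
apply Rle_lt_trans with (M u * ln (s * M s)).
- apply Rmult_le_compat_r; [|exact Hm'].
  pose proof (ln_Rmax_e_ge1 (s * M s)) as H. rewrite Rmax_right in H by lra. lra.
- apply Rmult_lt_compat_l; [lra|]. apply ln_increasing; lra.
Qed.

Lemma Mlog_cont : continuous_nonneg (Mlog M).
Proof.
intros s Hs. unfold Mlog.
assert (Hid : filterlim (fun u : R => u) (within (fun u => 0 <= u) (locally s)) (locally s)).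
{ exact (filter_le_within (F := locally s) (fun u => 0 <= u)). }
assert (Hmul : forall f g, filterlim f (within (fun u => 0 <= u) (locally s)) (locally (f s)) ->
   filterlim g (within (fun u => 0 <= u) (locally s)) (locally (g s)) ->
   filterlim (fun u => f u * g u) (within (fun u => 0 <= u) (locally s)) (locally (f s * g s))).
{ intros f g Hf Hg. eapply filterlim_comp_2; [exact Hf | exact Hg |].
  apply (filterlim_mult (K := R_AbsRing)). }
apply (Hmul M (fun s => ln (Rmax (exp 1) (s * M s)))).
- exact (Mcont s Hs).
- apply (filterlim_comp _ _ _ (fun u => u * M u) (fun y => ln (Rmax (exp 1) y)))
    with (locally (s * M s)).
  + apply (Hmul (fun u => u) M); [exact Hid | exact (Mcont s Hs)].
  + apply (continuous_comp (fun y => Rmax (exp 1) y) ln).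
    * apply (continuous_ext (fun y => / 2 * (exp 1 + y + Rabs (exp 1 - y)))).
      { intros y. unfold Rmax, Rabs. destruct (Rle_dec (exp 1) y); destruct (Rcase_abs (exp 1 - y)); lra. }
      apply (continuous_scal_r (/ 2) (fun y : R => exp 1 + y + Rabs (exp 1 - y))).
      apply (continuous_plus (fun y : R => exp 1 + y) (fun y => Rabs (exp 1 - y))).
      { apply (continuous_plus (fun y : R => exp 1) (fun y => y)); [apply continuous_const | apply continuous_id]. }
      apply (continuous_comp (fun y : R => exp 1 - y) Rabs).
      { apply (continuous_minus (fun y : R => exp 1) (fun y => y)); [apply continuous_const | apply continuous_id]. }
      apply continuous_Rabs.
    * apply continuity_pt_filterlim. apply derivable_continuous_pt.
      exists (/ Rmax (exp 1) (s * M s)). apply derivable_pt_lim_ln.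
      apply Rlt_le_trans with (exp 1); [apply exp_pos | apply Rmax_l].
Qed.

Lemma Mlog_unbounded B : exists s, 0 <= s /\ B < Mlog M s.
Proof.
pose proof (Mpos 0 (Rle_refl 0)) as H0.
set (s := exp (Rabs B / M 0 + 1) / M 0).
assert (Hs : 0 < s) by (apply Rdiv_lt_0_compat; [apply exp_pos | lra]).
exists s. split; [lra|].
pose proof (Mincr 0 s (Rle_refl 0) (Rlt_le _ _ Hs)) as Hm.
assert (Hl : Rabs B / M 0 + 1 <= ln (Rmax (exp 1) (s * M s))).
{ rewrite <- (ln_exp (Rabs B / M 0 + 1)) at 1. apply ln_le; [apply exp_pos|].
  apply Rle_trans with (2 := Rmax_r _ _).
  apply Rle_trans with (s * M 0); [right; unfold s; field; lra|].
  apply Rmult_le_compat_l; lra. }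
assert (0 <= Rabs B / M 0).
{ apply Rmult_le_pos; [apply Rabs_pos | apply Rlt_le, Rinv_0_lt_compat, H0]. }
unfold Mlog. apply Rlt_le_trans with (M 0 * (Rabs B / M 0 + 1)).
- replace (M 0 * (Rabs B / M 0 + 1)) with (Rabs B + M 0) by (field; lra).
  pose proof (Rle_abs B). lra.
- apply Rmult_le_compat; lra.
Qed.

Lemma Mlog_right_inverse_unique g1 g2 :
  is_rc_right_inverse (Mlog M) g1 -> is_rc_right_inverse (Mlog M) g2 ->
  Rbar_locally p_infty (fun tau => g1 tau = g2 tau).
Proof.
intros [b1 H1] [b2 H2].
pose (s0 := exp 1 / M 0).
assert (Hs0 : 0 <= s0).
{ pose proof (Mpos 0 (Rle_refl 0)). apply Rlt_le, Rdiv_lt_0_compat; [apply exp_pos | lra]. }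
exists (Rmax (Rmax b1 b2) (Mlog M s0)). intros tau Htau.
pose proof (Rmax_l (Rmax b1 b2) (Mlog M s0)). pose proof (Rmax_r (Rmax b1 b2) (Mlog M s0)).
pose proof (Rmax_l b1 b2). pose proof (Rmax_r b1 b2).
destruct (H1 tau) as (P1 & E1 & _); [lra|].
destruct (H2 tau) as (P2 & E2 & _); [lra|].
assert (L1 : s0 < g1 tau).
{ destruct (Rlt_le_dec s0 (g1 tau)) as [|h]; [assumption|].
  pose proof (Mlog_incr _ _ P1 h). lra. }
assert (L2 : s0 < g2 tau).
{ destruct (Rlt_le_dec s0 (g2 tau)) as [|h]; [assumption|].
  pose proof (Mlog_incr _ _ P2 h). lra. }
destruct (Rtotal_order (g1 tau) (g2 tau)) as [h|[h|h]]; [|exact h|].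
- pose proof (Mlog_strict _ _ L1 h). lra.
- pose proof (Mlog_strict _ _ L2 h). lra.
Qed.

Lemma Mlog_right_inverse_exists : exists g, is_rc_right_inverse (Mlog M) g.
Proof.
pose (E := fun tau s => 0 <= s /\ Mlog M s <= tau).
pose (g := fun tau => real (Lub_Rbar (E tau))).
assert (Hg : forall tau, Mlog M 0 < tau -> is_lub_Rbar (E tau) (Finite (g tau)) /\ 0 <= g tau).
{ intros tau Ht. unfold g. pose proof (Lub_Rbar_correct (E tau)) as HL.
  destruct HL as [Hub Hlb].
  destruct (Mlog_unbounded tau) as (S & HS & HMS).
  assert (H0 : Rbar_le 0 (Lub_Rbar (E tau))) by (apply Hub; split; lra).
  assert (H1 : Rbar_le (Lub_Rbar (E tau)) S).
  { apply Hlb. intros s [Hs HMs]. simpl.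
    destruct (Rle_lt_dec s S) as [h|h]; [exact h|].
    pose proof (Mlog_incr S s HS (Rlt_le _ _ h)). lra. }
  destruct (Lub_Rbar (E tau)) as [r| |]; simpl in *; try contradiction.
  split; [split|]; assumption. }
assert (Habove : forall tau s, Mlog M 0 < tau -> g tau < s -> tau < Mlog M s).
{ intros tau s Ht Hs. destruct (Hg tau Ht) as [[Hub _] Hp].
  destruct (Rlt_le_dec tau (Mlog M s)) as [h|h]; [exact h|].
  assert (Hc : Rbar_le s (g tau)) by (apply Hub; split; lra).
  simpl in Hc. lra. }
assert (Hbelow : forall tau s, Mlog M 0 < tau -> 0 <= s -> s < g tau -> Mlog M s <= tau).
{ intros tau s Ht Hs0 Hs. destruct (Hg tau Ht) as [[_ Hlb] Hp].
  destruct (Rle_lt_dec (Mlog M s) tau) as [h|h]; [exact h|].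
  assert (Hc : Rbar_le (g tau) s).
  { apply Hlb. intros u [Hu HMu]. simpl.
    destruct (Rle_lt_dec u s) as [k|k]; [exact k|].
    pose proof (Mlog_incr s u Hs0 (Rlt_le _ _ k)). lra. }
  simpl in Hc. lra. }
exists g. exists (Mlog M 0). intros tau Ht.
destruct (Hg tau Ht) as [_ Hp]. split; [exact Hp|]. split.
- assert (Hcl : forall eps : posreal, exists d : posreal, forall u,
    0 <= u -> Rabs (u - g tau) < d -> Rabs (Mlog M u - Mlog M (g tau)) < eps).
  { intros eps. destruct (proj1 (filterlim_locally _ _) (Mlog_cont (g tau) Hp) eps) as [d Hd].
    exists d. intros u Hu Hud. exact (Hd u Hud Hu). }
  apply Rle_antisym.
  + apply Rnot_lt_le. intros Hlt.
    destruct (Hcl (mkposreal _ (proj2 (Rlt_0_minus _ _) Hlt))) as [d Hd]. simpl in Hd.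
    destruct (Req_dec (g tau) 0) as [h0|h0]; [rewrite h0 in Hlt; lra|].
    pose proof (cond_pos d).
    pose (u := g tau - Rmin (g tau) (d / 2)).
    pose proof (Rmin_l (g tau) (d / 2)). pose proof (Rmin_r (g tau) (d / 2)).
    assert (0 < Rmin (g tau) (d / 2)) by (apply Rmin_glb_lt; lra).
    assert (Hu : 0 <= u) by (unfold u; lra).
    assert (Hd1 : Rabs (u - g tau) < d).
    { unfold u. rewrite Rabs_left; lra. }
    pose proof (Hd u Hu Hd1) as Hd2. apply Rabs_def2 in Hd2.
    assert (Mlog M u <= tau) by (apply Hbelow; unfold u in *; lra). lra.
  + apply Rnot_lt_le. intros Hlt.
    destruct (Hcl (mkposreal _ (proj2 (Rlt_0_minus _ _) Hlt))) as [d Hd]. simpl in Hd.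
    pose proof (cond_pos d).
    assert (Hd1 : Rabs (g tau + d / 2 - g tau) < d).
    { rewrite Rabs_pos_eq; lra. }
    assert (Hu : 0 <= g tau + d / 2) by lra.
    pose proof (Hd _ Hu Hd1) as Hd2. apply Rabs_def2 in Hd2.
    assert (tau < Mlog M (g tau + d / 2)) by (apply Habove; lra). lra.
- apply filterlim_locally. intros eps. pose proof (cond_pos eps).
  assert (Ha : tau < Mlog M (g tau + eps / 2)) by (apply Habove; lra).
  exists (mkposreal _ (proj2 (Rlt_0_minus _ _) Ha)). intros u Hu Htu.
  change (Rabs (u - tau) < Mlog M (g tau + eps / 2) - tau) in Hu.
  change (Rabs (g u - g tau) < eps). apply Rabs_def2 in Hu.
  assert (Htu0 : Mlog M 0 < u) by lra.
  assert (H1 : g u <= g tau + eps / 2).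
  { apply Rnot_lt_le. intros k.
    assert (Mlog M (g tau + eps / 2) <= u) by (apply Hbelow; lra). lra. }
  assert (H2 : g tau <= g u).
  { apply Rnot_lt_le. intros k. destruct (Hg u Htu0) as [_ Hpu].
    pose (m := (g u + g tau) / 2).
    assert (u < Mlog M m) by (apply Habove; unfold m; lra).
    assert (Mlog M m <= tau) by (apply Hbelow; unfold m; lra). lra. }
  rewrite Rabs_pos_eq; lra.
Qed.

End MlogInverse.

(* Main.v *)
Require Import Defs.
From Stdlib Require Import Reals Lra Lia List Arith Factorial.
From Coquelicot Require Import Coquelicot.
Open Scope R_scope.

(** Let [R = Mlog_inv (c t)] and [m = M R], so that [c t = m ln (R m)] for large [t],
    and let [u(x) = T(x) A^-1 y] with [|y| <= 1]. This orbit is Lipschitz, since its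
    derivative is [T(x) y]. Convolution with a kernel of width [1/R] therefore changes
    [u(t)] by [O(1/R)] only. If the kernel has its frequencies in [[-R, R]], the smoothed
    orbit is an average of the Fourier transform of [u] over [[-R, R]], where the
    resolvent is bounded by [m].

    To make the smoothed orbit small, [u] is first multiplied by the weight
    [p(x) = (x (N - x))^k / (t (N - t))^k] on [[0, N]], [N = L t], where [p(t) = 1]. Full
    integration by parts expresses the Fourier transform of [p u] by the derivatives
    of [p] at [0] and [N] and the powers of the resolvent. As [p] vanishes to order [k] at both
    ends, the result is about [k! (m/t)^k] times the resolvent
    ([norm_weight_integral_le], [end_bound_ratio]), and this is of size [exp(-k)] for
    [k = floor (t/m)], that is, [(R m)^(-1/c)] up to a loss that is as small as desired
    for large [L]. On the range of [A^-1] the resolvent at [i s] is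
    [O(m / (1 + |s|))] ([resolvent_decay]); its average over [[-R, R]] is of order
    [m ln R / R], which becomes [m ln R] after division by the mass of the kernel, of
    order [1/R]. As [c < 1], the product of [m ln R] with [k exp(-k)] is still [O(1/R)]
    ([decay_numeric]).

    The weight must not spoil the smoothing error. Near [t] its slope is at most of
    order [k/t <= 1/m]; far from [t] it is at most a power of [R m], because [k] is at most
    [ln (R m) / c]. A kernel that decays like a high power, depending on [c] only,
    absorbs this ([weight_deviation], [smoothing_error]). The kernel is a power of
    [sinc], and each factor [sinc] amounts to an average over a short interval of
    frequencies ([sinc_average], [iterated_average]). So neither Fourier inversion nor
    a continuation of the resolvent beyond the imaginary axis is used, and all
    integrals extend over bounded intervals. *)

(** * Linear identities in real modules *)

(** Syntax of linear combinations of vectors. Two of them agree as soon as their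
    coefficients do, and equality of coefficients is left to [ring] or [field]. *)
Inductive lin_expr :=
  | LAtom (n : nat) | LZero | LPlus (a b : lin_expr) | LOpp (a : lin_expr)
  | LScal (r : R) (a : lin_expr).

Fixpoint lin_eval {V : ModuleSpace R_Ring} (env : list V) (e : lin_expr) : V :=
  match e with
  | LAtom n => nth n env zero
  | LZero => zero
  | LPlus a b => plus (lin_eval env a) (lin_eval env b)
  | LOpp a => opp (lin_eval env a)
  | LScal r a => scal r (lin_eval env a)
  end.

Fixpoint lin_coef (e : lin_expr) (i : nat) : R :=
  match e with
  | LAtom n => if Nat.eqb n i then 1 else 0
  | LZero => 0
  | LPlus a b => lin_coef a i + lin_coef b i
  | LOpp a => - lin_coef a i
  | LScal r a => r * lin_coef a i
  end.

Fixpoint lin_comb {V : ModuleSpace R_Ring} (env : list V) (c : nat -> R) : V :=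
  match env with
  | nil => zero
  | v :: env' => plus (scal (c 0%nat) v) (lin_comb env' (fun i => c (S i)))
  end.

Fixpoint lin_same (n : nat) (c d : nat -> R) : Prop :=
  match n with
  | O => True
  | S n' => c 0%nat = d 0%nat /\ lin_same n' (fun i => c (S i)) (fun i => d (S i))
  end.

Lemma plus_plus_swap {V : AbelianMonoid} (a b c d : V) :
  plus (plus a b) (plus c d) = plus (plus a c) (plus b d).
Proof.
rewrite <- !plus_assoc. f_equal. rewrite !plus_assoc. f_equal. apply plus_comm.
Qed.

Lemma lin_eval_comb {V : ModuleSpace R_Ring} (env : list V) e :
  lin_eval env e = lin_comb env (lin_coef e).
Proof.
assert (Hz : forall env : list V, lin_comb env (fun _ => 0) = zero).
{ intros l; induction l as [|v l IH]; simpl; [reflexivity|].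
  rewrite IH, plus_zero_r. apply (scal_zero_l v). }
induction e as [n| |a IHa b IHb|a IHa|r a IHa]; simpl.
- revert n; induction env as [|v env IH]; intros [|n]; simpl; try reflexivity.
  + rewrite Hz, plus_zero_r. symmetry. apply (scal_one v).
  + rewrite (IH n). simpl. rewrite <- (plus_zero_l (lin_comb env _)) at 1. f_equal.
    symmetry. apply (scal_zero_l v).
- symmetry. apply Hz.
- rewrite IHa, IHb. generalize (lin_coef a) (lin_coef b). clear.
  induction env as [|v env IH]; intros c d; simpl; [apply plus_zero_l|].
  rewrite plus_plus_swap, IH. f_equal. symmetry. apply (scal_distr_r (c 0%nat) (d 0%nat) v).
- rewrite IHa. generalize (lin_coef a). clear.
  induction env as [|v env IH]; intros c; simpl; [apply (@opp_zero V)|].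
  transitivity (plus (opp (scal (c 0%nat) v)) (opp (lin_comb env (fun i => c (S i))))).
  { apply (@opp_plus V). }
  rewrite IH. f_equal. symmetry. apply (scal_opp_l (c 0%nat) v).
- rewrite IHa. generalize (lin_coef a). clear.
  induction env as [|v env IH]; intros c; simpl; [apply scal_zero_r|].
  rewrite scal_distr_l, IH. f_equal. apply (scal_assoc r (c 0%nat) v).
Qed.

Lemma lin_eval_eq {V : ModuleSpace R_Ring} (env : list V) e1 e2 :
  lin_same (length env) (lin_coef e1) (lin_coef e2) ->
  lin_eval env e1 = lin_eval env e2.
Proof.
rewrite !lin_eval_comb. generalize (lin_coef e1) (lin_coef e2).
induction env as [|v env IH]; intros c d; simpl; [reflexivity|].
intros [H0 H]. rewrite H0. f_equal. apply IH, H.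
Qed.

(** The position of [x] in [l]; fails when [x] does not occur, which is how
    [lin_atoms] recognises a new vector. *)
Ltac lin_find x l :=
  lazymatch l with
  | cons x _ => constr:(O)
  | cons _ ?l' => let n := lin_find x l' in constr:(S n)
  end.
Ltac lin_atoms T e l :=
  lazymatch e with
  | plus ?a ?b => let l1 := lin_atoms T a l in lin_atoms T b l1
  | minus ?a ?b => let l1 := lin_atoms T a l in lin_atoms T b l1
  | opp ?a => lin_atoms T a l
  | scal _ ?a => lin_atoms T a l
  | zero => l
  | ?x => match l with
          | _ => let n := lin_find x l in l
          | _ => constr:(@cons T x l)
          end
  end.
Ltac lin_reify e l :=
  lazymatch e with
  | plus ?a ?b => let a' := lin_reify a l in let b' := lin_reify b l in constr:(LPlus a' b')
  | minus ?a ?b =>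
      let a' := lin_reify a l in let b' := lin_reify b l in constr:(LPlus a' (LOpp b'))
  | opp ?a => let a' := lin_reify a l in constr:(LOpp a')
  | scal ?r ?a => let a' := lin_reify a l in constr:(LScal r a')
  | zero => constr:(LZero)
  | ?x => let n := lin_find x l in constr:(LAtom n)
  end.
Ltac lin_decide T tac :=
  lazymatch goal with
  | |- ?a = ?b =>
    let l0 := lin_atoms T a (@nil T) in
    let l := lin_atoms T b l0 in
    let a' := lin_reify a l in
    let b' := lin_reify b l in
    apply (lin_eval_eq l a' b'); simpl; repeat split; tac
  end.
Ltac module_eq_with tac :=
  lazymatch goal with |- @eq ?T _ _ => lin_decide T tac end.
Ltac module_eq := module_eq_with ltac:(try ring).
Ltac module_eq_in V := lin_decide (ModuleSpace.sort R_Ring V) ltac:(try ring).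

(** * Real Banach spaces with a complex structure *)

Section Norm.
Variable V : CompleteNormedModule R_AbsRing.

Lemma norm_plus_le (x y : V) : norm (plus x y) <= norm x + norm y.
Proof. apply (norm_triangle (K := R_AbsRing) (V := V)). Qed.

Lemma norm_opp_eq (x : V) : norm (opp x) = norm x.
Proof. apply (norm_opp (K := R_AbsRing) (V := V)). Qed.

Lemma norm_minus_le (x y : V) : norm (minus x y) <= norm x + norm y.
Proof. rewrite <- (norm_opp_eq y). apply norm_plus_le. Qed.

Lemma norm_scal_le (r : R) (x : V) : norm (scal r x) <= Rabs r * norm x.
Proof. apply (norm_scal (K := R_AbsRing) (V := V)). Qed.

Lemma norm_scal_eq (r : R) (x : V) : norm (scal r x) = Rabs r * norm x.
Proof.
apply Rle_antisym; [apply norm_scal_le|].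
destruct (Req_dec r 0) as [->|Hr]; [rewrite Rabs_R0, Rmult_0_l; apply norm_ge_0|].
replace x with (scal (/ r) (scal r x)) at 1 by (module_eq_with ltac:(try (field; exact Hr))).
eapply Rle_trans; [apply Rmult_le_compat_l; [apply Rabs_pos|apply norm_scal_le]|].
rewrite <- Rmult_assoc, <- Rabs_mult, Rinv_r, Rabs_R1 by exact Hr. lra.
Qed.

Lemma norm_zero_eq : norm (zero : V) = 0.
Proof. apply (norm_zero (K := R_AbsRing) (V := V)). Qed.
End Norm.

Lemma is_derive_scal_fct {V : NormedModule R_AbsRing} (a : R -> R) (f : R -> V) x da df :
  is_derive a x da -> is_derive f x df ->
  is_derive (fun t => scal (a t) (f t)) x (plus (scal da (f x)) (scal (a x) df)).
Proof.
intros Ha Hf. unfold is_derive in *.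
eapply filterdiff_ext_lin.
- apply (filterdiff_scal_fct (K := R_AbsRing) x a f _ _ Rmult_comm Ha Hf).
- intros y. simpl. rewrite scal_distr_l, !scal_assoc.
  f_equal. f_equal. apply Rmult_comm.
Qed.

Lemma is_derive_linear {V : NormedModule R_AbsRing} (J : V -> V) (f : R -> V) x df :
  is_linear J -> is_derive f x df -> is_derive (fun t => J (f t)) x (J df).
Proof.
intros HJ Hf. unfold is_derive in *.
eapply filterdiff_ext_lin.
- apply (filterdiff_comp' f J x _ J Hf). apply filterdiff_linear. exact HJ.
- intros y. simpl. apply (linear_scal J HJ).
Qed.

Lemma continuous_linear {V : NormedModule R_AbsRing} (J : V -> V) (f : R -> V) x :
  is_linear J -> continuous f x -> continuous (fun t => J (f t)) x.
Proof.
intros HJ Hf. apply (continuous_comp f J); [exact Hf|].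
apply filterdiff_continuous. exists J. apply filterdiff_linear. exact HJ.
Qed.

(** Multiplication by [exp (i a)] when [J] is multiplication by [i]. *)
Definition rot {V : NormedModule R_AbsRing} (J : V -> V) (a : R) (x : V) : V :=
  plus (scal (cos a) x) (scal (sin a) (J x)).

(** A complex Banach space seen as a real one: the Riemann integral and the
    derivative used below need real scalars, and [J] keeps track of [i]. *)
Record complex_structure {V : NormedModule R_AbsRing} (J : V -> V) : Prop := {
  cs_linear : is_linear J;
  cs_square : forall x, J (J x) = opp x;
  cs_isometry : forall a x, norm (rot J a x) <= norm x }.

Section Rotation.
Variables (V : CompleteNormedModule R_AbsRing) (J : V -> V).
Hypothesis HJ : complex_structure J.

Lemma rot_scal a (k : R) x : rot J a (scal k x) = scal k (rot J a x).
Proof.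
unfold rot. rewrite (linear_scal J (cs_linear _ HJ)). module_eq.
Qed.

Lemma rot_rot a b x : rot J a (rot J b x) = rot J (a + b) x.
Proof.
unfold rot. rewrite (linear_plus J (cs_linear _ HJ)), !(linear_scal J (cs_linear _ HJ)), (cs_square _ HJ).
rewrite cos_plus, sin_plus. module_eq.
Qed.

Lemma rot_0 x : rot J 0 x = x.
Proof. unfold rot. rewrite cos_0, sin_0. module_eq. Qed.

Lemma rot_opp_plus a x : plus (rot J a x) (rot J (- a) x) = scal (2 * cos a) x.
Proof. unfold rot. rewrite cos_neg, sin_neg. module_eq. Qed.

Lemma is_derive_rot (th : R -> R) (f : R -> V) x dth df :
  is_derive th x dth -> is_derive f x df ->
  is_derive (fun t => rot J (th t) (f t)) x
    (rot J (th x) (plus df (scal dth (J (f x))))).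
Proof.
intros Hth Hf. unfold rot at 1.
evar_last.
- apply (is_derive_plus (K := R_AbsRing) (fun t => scal (cos (th t)) (f t)) (fun t => scal (sin (th t)) (J (f t)))).
  + apply (is_derive_scal_fct (fun t => cos (th t)) f x (scal dth (- sin (th x))) df); [|exact Hf].
    apply (is_derive_comp cos th); [apply is_derive_cos | exact Hth].
  + apply (is_derive_scal_fct (fun t => sin (th t)) (fun t => J (f t)) x
      (scal dth (cos (th x))) (J df)); [|apply is_derive_linear; [apply HJ|exact Hf]].
    apply (is_derive_comp sin th); [apply is_derive_sin | exact Hth].
- unfold rot. rewrite (linear_plus J (cs_linear _ HJ)), !(linear_scal J (cs_linear _ HJ)), (cs_square _ HJ).
  change (scal dth (- sin (th x))) with (dth * - sin (th x)).
  change (scal dth (cos (th x))) with (dth * cos (th x)).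
  module_eq.
Qed.

Lemma continuous_rot (th : R -> R) (f : R -> V) x :
  continuous th x -> continuous f x -> continuous (fun t => rot J (th t) (f t)) x.
Proof.
intros Hth Hf. unfold rot.
apply (continuous_plus (fun t => scal (cos (th t)) (f t)) (fun t => scal (sin (th t)) (J (f t)))).
- apply (continuous_scal (fun t => cos (th t)) f); [|exact Hf].
  apply (continuous_comp th cos); [exact Hth|apply continuous_cos].
- apply (continuous_scal (fun t => sin (th t)) (fun t => J (f t))).
  + apply (continuous_comp th sin); [exact Hth|apply continuous_sin].
  + apply continuous_linear; [apply HJ|exact Hf].
Qed.

End Rotation.

(** * Averaging over frequencies *)

Lemma sin_increment x y : exists z, Rabs (z - x) <= Rabs (y - x) /\ sin y - sin x = cos z * (y - x).
Proof.
destruct (MVT_gen sin x y cos) as [z [Hz E]].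
- intros z _. apply is_derive_sin.
- intros z _. apply continuity_sin.
- exists z. split; [|exact E].
  unfold Rmin, Rmax in Hz. destruct (Rle_dec x y); unfold Rabs; repeat destruct Rcase_abs; lra.
Qed.

Lemma Rabs_cos_le1 x : Rabs (cos x) <= 1.
Proof. pose proof (COS_bound x). apply Rabs_le. lra. Qed.
Lemma Rabs_sin_le1 x : Rabs (sin x) <= 1.
Proof. pose proof (SIN_bound x). apply Rabs_le. lra. Qed.

Lemma sin_lipschitz x y : Rabs (sin y - sin x) <= Rabs (y - x).
Proof.
destruct (sin_increment x y) as [z [_ E]]. rewrite E, Rabs_mult.
pose proof (Rabs_cos_le1 z). pose proof (Rabs_pos (y - x)). nra.
Qed.

Lemma cos_lipschitz x y : Rabs (cos y - cos x) <= Rabs (y - x).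
Proof.
pose proof (sin_lipschitz (PI / 2 + x) (PI / 2 + y)) as H.
rewrite <- !cos_sin in H. replace (PI / 2 + y - (PI / 2 + x)) with (y - x) in H by ring. exact H.
Qed.

Lemma sin_taylor x y : Rabs (sin y - sin x - (y - x) * cos x) <= (y - x) ^ 2.
Proof.
destruct (sin_increment x y) as [z [Hz E]]. rewrite E.
replace (cos z * (y - x) - (y - x) * cos x) with ((y - x) * (cos z - cos x)) by ring.
rewrite Rabs_mult. pose proof (cos_lipschitz x z). pose proof (Rabs_pos (y - x)).
rewrite <- (pow2_abs (y - x)). nra.
Qed.

Definition sinc (x : R) : R := if Req_EM_T x 0 then 1 else sin x / x.

Lemma sinc_mult x : x * sinc x = sin x.
Proof.
unfold sinc. destruct (Req_EM_T x 0) as [->|H]; [rewrite sin_0; ring | field; exact H].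
Qed.

Lemma Rabs_sinc_le1 x : Rabs (sinc x) <= 1.
Proof.
unfold sinc. destruct (Req_EM_T x 0) as [->|H]; [rewrite Rabs_R1; lra|].
pose proof (sin_lipschitz 0 x) as Hl. rewrite sin_0, !Rminus_0_r in Hl.
unfold Rdiv. rewrite Rabs_mult, Rabs_inv. pose proof (Rabs_pos_lt x H).
apply (Rmult_le_reg_r (Rabs x)); [assumption|]. field_simplify; lra.
Qed.

Lemma sinc_near0 x : Rabs (sinc x - 1) <= Rabs x.
Proof.
unfold sinc. destruct (Req_EM_T x 0) as [->|H].
- rewrite Rminus_diag, Rabs_R0. lra.
- pose proof (sin_taylor 0 x) as Hl. rewrite sin_0, cos_0, !Rminus_0_r, Rmult_1_r in Hl.
  replace (sin x / x - 1) with ((sin x - x) / x) by (field; exact H).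
  unfold Rdiv. rewrite Rabs_mult, Rabs_inv. pose proof (Rabs_pos_lt x H).
  apply (Rmult_le_reg_r (Rabs x)); [assumption|].
  rewrite <- (pow2_abs x) in Hl. field_simplify; lra.
Qed.

Lemma continuous_sinc x : continuous sinc x.
Proof.
destruct (Req_dec x 0) as [->|H].
- apply filterlim_locally. intros eps. exists eps. intros y Hy.
  change (Rabs (sinc y - sinc 0) < eps). change (Rabs (y - 0) < eps) in Hy.
  unfold sinc at 2. destruct (Req_EM_T 0 0) as [_|h]; [|lra].
  pose proof (sinc_near0 y). rewrite Rminus_0_r in Hy. lra.
- apply (continuous_ext_loc _ (fun y => sin y / y)).
  + exists (mkposreal _ (Rabs_pos_lt x H)). intros y Hy.
    change (Rabs (y - x) < Rabs x) in Hy. unfold sinc.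
    destruct (Req_EM_T y 0) as [->|]; [|reflexivity].
    rewrite Rminus_0_l, Rabs_Ropp in Hy. lra.
  + apply continuity_pt_filterlim. apply derivable_continuous_pt.
    apply derivable_pt_div; [apply derivable_pt_sin|apply derivable_pt_id|exact H].
Qed.

(** The derivative of [s * sinc (s * v)] with respect to [s] is [cos (s * v)], with
    an error that is uniform for [v] in a bounded set; this is what allows to
    differentiate under the integral sign in [sinc_average]. *)
Lemma sinc_taylor v s h :
  Rabs ((s + h) * sinc ((s + h) * v) - s * sinc (s * v) - h * cos (s * v)) <= h ^ 2 * Rabs v.
Proof.
destruct (Req_dec v 0) as [->|Hv].
- rewrite !Rmult_0_r, cos_0, Rabs_R0. unfold sinc. destruct (Req_EM_T 0 0); [|lra].
  rewrite !Rmult_1_r, Rmult_0_r. replace (s + h - s - h) with 0 by ring. rewrite Rabs_R0. lra.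
- pose proof (Rabs_pos_lt v Hv) as Hp.
  apply (Rmult_le_reg_r (Rabs v)); [exact Hp|]. rewrite <- Rabs_mult.
  replace (h ^ 2 * Rabs v * Rabs v) with (h ^ 2 * (Rabs v) ^ 2) by ring. rewrite pow2_abs.
  pose proof (sin_taylor (s * v) ((s + h) * v)) as H.
  rewrite <- (sinc_mult (s * v)), <- (sinc_mult ((s + h) * v)) in H.
  replace (h ^ 2 * v ^ 2) with (((s + h) * v - s * v) ^ 2) by ring.
  eapply Rle_trans; [|exact H]. right. f_equal. ring.
Qed.

Lemma is_derive_small {V : NormedModule R_AbsRing} (f : R -> V) x l :
  (forall eps : posreal, exists d : posreal, forall h, Rabs h < d ->
     norm (minus (minus (f (x + h)) (f x)) (scal h l)) <= eps * Rabs h) ->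
  is_derive f x l.
Proof.
intros H. split; [apply is_linear_scal_l|].
intros y Hy. pose proof (@is_filter_lim_locally_unique R_AbsRing R_NormedModule x y Hy) as E. subst y.
intros eps. destruct (H eps) as [d Hd].
exists d. intros z Hz. specialize (Hd (z - x) Hz). rewrite (Rplus_minus x z) in Hd. exact Hd.
Qed.

Lemma is_derive_quadratic {V : NormedModule R_AbsRing} (f : R -> V) x l C :
  (forall h, norm (minus (minus (f (x + h)) (f x)) (scal h l)) <= C * h ^ 2) ->
  is_derive f x l.
Proof.
intros H. apply is_derive_small. intros eps.
assert (HC : 0 < Rabs C + 1) by (pose proof (Rabs_pos C); lra).
assert (Hd : 0 < eps / (Rabs C + 1)) by (apply Rdiv_lt_0_compat; [apply eps|lra]).
exists (mkposreal _ Hd). intros h Hh. simpl in Hh.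
eapply Rle_trans; [apply H|]. rewrite <- (pow2_abs h).
pose proof (Rabs_pos h). pose proof (Rle_abs C).
assert (Rabs h * (Rabs C + 1) < eps).
{ apply (Rmult_lt_compat_r (Rabs C + 1)) in Hh; [|exact HC].
  replace (eps / (Rabs C + 1) * (Rabs C + 1)) with (pos eps) in Hh by (field; lra). exact Hh. }
replace (C * Rabs h ^ 2) with ((C * Rabs h) * Rabs h) by ring.
apply Rmult_le_compat_r; [assumption|]. nra.
Qed.

Lemma norm_RInt_scal_le {V : CompleteNormedModule R_AbsRing} (w : R -> R) (g : R -> V) a b e :
  a <= b -> (forall x, continuous w x) -> (forall x, continuous g x) ->
  (forall x, a <= x <= b -> Rabs (w x) <= e) ->
  norm (RInt (fun x => scal (w x) (g x)) a b) <= e * RInt (fun x => norm (g x)) a b.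
Proof.
intros Hab Hw Hg He.
apply (norm_RInt_le (fun x => scal (w x) (g x)) (fun x => e * norm (g x)) a b).
- exact Hab.
- intros x Hx. eapply Rle_trans; [apply (norm_scal (K := R_AbsRing) (V := V))|].
  apply Rmult_le_compat_r; [apply norm_ge_0|apply He, Hx].
- apply (RInt_correct (V := V)). apply ex_RInt_continuous. intros x _.
  apply (continuous_scal w g); auto.
- apply (is_RInt_scal (V := R_NormedModule) (fun x => norm (g x))).
  apply (RInt_correct (V := R_CompleteNormedModule)). apply (ex_RInt_continuous (V := R_CompleteNormedModule)).
  intros x _. apply (continuous_comp g norm); [apply Hg|apply (filterlim_norm (K := R_AbsRing) (V := V))].
Qed.

Section Averaging.
Variables (V : CompleteNormedModule R_AbsRing) (J : V -> V).
Hypothesis HJ : complex_structure J.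

(** [sinc (d v)] is the mean of [exp (i s v)] over [-d <= s <= d], so that inserting
    the factor [sinc] under the integral replaces the Fourier transform
    [F s] of [g] by its mean over [[s0 - d, s0 + d]], which is at most the mean of
    its bound [B']. In place of a Fubini theorem, the proof differentiates
    [H s], the integral with weight [s sinc (s v)], for which
    [H' s = (F (s0 + s) + F (s0 - s)) / 2]. *)
Lemma sinc_average (g : R -> V) (a b t d s0 : R) (B B' : R -> R) :
  a <= b -> 0 < d -> (forall x, continuous g x) ->
  (forall s, is_derive B s (B' s)) -> (forall s, continuous B' s) ->
  (forall s, s0 - d <= s <= s0 + d ->
     norm (RInt (fun x => rot J (s * (t - x)) (g x)) a b) <= B' s) ->
  norm (RInt (fun x => scal (sinc (d * (t - x))) (rot J (s0 * (t - x)) (g x))) a b)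
    <= (B (s0 + d) - B (s0 - d)) / (2 * d).
Proof.
intros Hab Hd Hg HB HB' Hle.
set (G := fun x => rot J (s0 * (t - x)) (g x)).
assert (Hlin : forall s x, continuous (fun x => s * (t - x)) x).
{ intros s x. apply continuity_pt_filterlim. apply derivable_continuous_pt. reg. }
assert (HG : forall x, continuous G x).
{ intros x. apply (continuous_rot V J HJ (fun x => s0 * (t - x))); auto. }
assert (Hcos : forall s x, continuous (fun x => cos (s * (t - x))) x).
{ intros s x. apply (continuous_comp (fun x => s * (t - x)) cos); [apply Hlin|apply continuous_cos]. }
assert (Hsinc : forall s x, continuous (fun x => s * sinc (s * (t - x))) x).
{ intros s x. apply (continuous_scal_r (V := R_NormedModule) s (fun x => sinc (s * (t - x)))).
  apply (continuous_comp (fun x => s * (t - x)) sinc); [apply Hlin|apply continuous_sinc]. }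
assert (Hex : forall w : R -> R, (forall x, continuous w x) ->
  is_RInt (fun x => scal (w x) (G x)) a b
    (RInt (fun x => scal (w x) (G x)) a b)).
{ intros w Hw. apply (RInt_correct (V := V)). apply ex_RInt_continuous. intros x _.
  apply (continuous_scal w G); auto. }
set (H := fun s => RInt (fun x => scal (s * sinc (s * (t - x))) (G x)) a b).
set (H' := fun s => RInt (fun x => scal (cos (s * (t - x))) (G x)) a b).
set (D := Rabs (t - a) + Rabs (t - b)).
assert (HD : forall x, a <= x <= b -> Rabs (t - x) <= D).
{ intros x Hx. unfold D, Rabs. repeat destruct Rcase_abs; lra. }
set (NG := RInt (fun x => norm (G x)) a b).
assert (HH' : forall s, 0 <= s <= d -> norm (H' s) <= (B' (s0 + s) + B' (s0 - s)) / 2).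
{ intros s [h1 h2].
  assert (E : H' s = scal (/ 2) (plus (RInt (fun x => rot J ((s0 + s) * (t - x)) (g x)) a b)
      (RInt (fun x => rot J ((s0 - s) * (t - x)) (g x)) a b))).
  { assert (Hex' : forall s, is_RInt (fun x => rot J (s * (t - x)) (g x)) a b
      (RInt (fun x => rot J (s * (t - x)) (g x)) a b)).
    { intros s'. apply (RInt_correct (V := V)). apply ex_RInt_continuous. intros x _.
      apply (continuous_rot V J HJ (fun x => s' * (t - x))); auto. }
    apply (is_RInt_unique (V := V)).
    eapply is_RInt_ext; [|apply (is_RInt_scal (V := V)); apply (is_RInt_plus (V := V)); apply Hex'].
    intros x _. simpl. unfold G.
    replace ((s0 + s) * (t - x)) with (s * (t - x) + s0 * (t - x)) by ring.
    replace ((s0 - s) * (t - x)) with (- (s * (t - x)) + s0 * (t - x)) by ring.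
    rewrite <- !rot_rot by exact HJ. rewrite rot_opp_plus. module_eq_with ltac:(try field). }
  rewrite E. eapply Rle_trans; [apply (norm_scal (K := R_AbsRing) (V := V))|].
  change (abs (/ 2)) with (Rabs (/ 2)). rewrite Rabs_pos_eq by lra.
  assert (norm (plus (RInt (fun x => rot J ((s0 + s) * (t - x)) (g x)) a b)
      (RInt (fun x => rot J ((s0 - s) * (t - x)) (g x)) a b)) <= B' (s0 + s) + B' (s0 - s)).
  { eapply Rle_trans; [apply (norm_triangle (K := R_AbsRing) (V := V))|]. apply Rplus_le_compat; apply Hle; lra. }
  lra. }
assert (Hder : forall s, is_derive H s (H' s)).
{ intros s. apply (is_derive_quadratic H s (H' s) (D * NG)). intros h.
  assert (E : minus (minus (H (s + h)) (H s)) (scal h (H' s)) =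
    RInt (fun x => scal ((s + h) * sinc ((s + h) * (t - x)) - s * sinc (s * (t - x)) - h * cos (s * (t - x))) (G x)) a b).
  { symmetry. apply (is_RInt_unique (V := V)).
    eapply is_RInt_ext; [|apply (is_RInt_minus (V := V));
      [apply (is_RInt_minus (V := V))|apply (is_RInt_scal (V := V))]; apply Hex; auto].
    intros x _. simpl.
    change (@scal R_AbsRing (CompleteNormedModule.ModuleSpace R_AbsRing V)) with (@scal R_AbsRing V).
    module_eq. }
  eapply Rle_trans; [right; exact (f_equal (@norm R_AbsRing V) E)|]. eapply Rle_trans.
  - apply (norm_RInt_scal_le _ G a b (h ^ 2 * D)); auto.
    + intros x. apply (continuous_minus (V := R_NormedModule)
        (fun x => (s + h) * sinc ((s + h) * (t - x)) - s * sinc (s * (t - x)))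
        (fun x => h * cos (s * (t - x)))).
      * apply (continuous_minus (V := R_NormedModule) (fun x => (s + h) * sinc ((s + h) * (t - x)))); apply Hsinc.
      * apply (continuous_scal_r (V := R_NormedModule) h (fun x => cos (s * (t - x)))). apply Hcos.
    + intros x Hx. eapply Rle_trans; [apply sinc_taylor|].
      apply Rmult_le_compat_l; [apply pow2_ge_0|apply HD, Hx].
  - fold NG. right. ring. }
assert (Hcont : forall s, continuous H' s).
{ intros s. apply (filterlim_locally_ball_norm (K := R_AbsRing) (U := V)). intros eps.
  assert (HNG : 0 <= NG).
  { apply RInt_ge_0; [exact Hab| |intros; apply norm_ge_0].
    apply (ex_RInt_continuous (V := R_CompleteNormedModule)). intros x _.
    apply (continuous_comp G norm); [apply HG|apply (filterlim_norm (K := R_AbsRing) (V := V))]. }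
  assert (HDp : 0 <= D) by (unfold D; pose proof (Rabs_pos (t - a)); pose proof (Rabs_pos (t - b)); lra).
  assert (HC : 0 < D * NG + 1) by (pose proof (Rmult_le_pos _ _ HDp HNG); lra).
  assert (Hdd : 0 < eps / (D * NG + 1)) by (apply Rdiv_lt_0_compat; [apply eps|lra]).
  exists (mkposreal _ Hdd). intros s' Hs'. change (Rabs (s' - s) < eps / (D * NG + 1)) in Hs'.
  unfold ball_norm.
  assert (E : minus (H' s') (H' s) = RInt (fun x => scal (cos (s' * (t - x)) - cos (s * (t - x))) (G x)) a b).
  { symmetry. apply (is_RInt_unique (V := V)).
    eapply is_RInt_ext; [|apply (is_RInt_minus (V := V)); apply Hex; auto].
    intros x _. simpl. module_eq. }
  eapply Rle_lt_trans; [right; exact (f_equal (@norm R_AbsRing V) E)|]. eapply Rle_lt_trans.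
  - apply (norm_RInt_scal_le _ G a b (Rabs (s' - s) * D)); auto.
    + intros x. apply (continuous_minus (V := R_NormedModule)
        (fun x => cos (s' * (t - x))) (fun x => cos (s * (t - x)))); apply Hcos.
    + intros x Hx. eapply Rle_trans; [apply cos_lipschitz|].
      replace (s' * (t - x) - s * (t - x)) with ((s' - s) * (t - x)) by ring. rewrite Rabs_mult.
      apply Rmult_le_compat_l; [apply Rabs_pos|apply HD, Hx].
  - fold NG. apply (Rmult_lt_compat_r (D * NG + 1)) in Hs'; [|exact HC].
    replace (eps / (D * NG + 1) * (D * NG + 1)) with (pos eps) in Hs' by (field; lra).
    pose proof (Rabs_pos (s' - s)). nra. }
assert (E0 : H 0 = zero).
{ unfold H. rewrite (RInt_ext _ (fun _ => zero)).
  - rewrite RInt_const. apply (scal_zero_r (K := R_Ring) (V := V)).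
  - intros x _. rewrite Rmult_0_l. apply (scal_zero_l (G x)). }
assert (Ed : norm (H d) <= (B (s0 + d) - B (s0 - d)) / 2).
{ replace (H d) with (minus (H d) (H 0)) by (rewrite E0; module_eq).
  replace ((B (s0 + d) - B (s0 - d)) / 2) with (minus ((B (s0 + d) - B (s0 - d)) / 2) ((B (s0 + 0) - B (s0 - 0)) / 2))
    by (unfold minus, plus, opp; simpl; rewrite Rplus_0_r, Rminus_0_r; field).
  apply (norm_RInt_le H' (fun s => (B' (s0 + s) + B' (s0 - s)) / 2) 0 d).
  - lra.
  - exact HH'.
  - apply is_RInt_derive; auto.
  - apply (is_RInt_derive (V := R_CompleteNormedModule) (fun s => (B (s0 + s) - B (s0 - s)) / 2)).
    + intros s _. auto_derive; [repeat split; eexists; apply HB|].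
      rewrite !(is_derive_unique (fun x => B x) _ _ (HB _)). unfold Rminus. field.
    + intros s _. apply (continuous_scal_l (V := R_NormedModule) (fun s => B' (s0 + s) + B' (s0 - s))).
      apply (continuous_plus (V := R_NormedModule) (fun s => B' (s0 + s)) (fun s => B' (s0 - s)));
        apply (continuous_comp _ B'); try apply HB';
        apply continuity_pt_filterlim; apply derivable_continuous_pt; reg. }
assert (EHd : H d = scal d (RInt (fun x => scal (sinc (d * (t - x))) (G x)) a b)).
{ apply (is_RInt_unique (V := V)). eapply is_RInt_ext; [|apply (is_RInt_scal (V := V)); apply Hex].
  - intros x _. simpl.
    change (@scal R_AbsRing (CompleteNormedModule.ModuleSpace R_AbsRing V)) with (@scal R_AbsRing V).
    module_eq.
  - intros x. apply (continuous_comp (fun x => d * (t - x)) sinc); [apply Hlin|apply continuous_sinc]. }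
change (norm (RInt (fun x => scal (sinc (d * (t - x))) (G x)) a b) <= (B (s0 + d) - B (s0 - d)) / (2 * d)).
replace (RInt (fun x => scal (sinc (d * (t - x))) (G x)) a b) with (scal (/ d) (H d))
  by (rewrite EHd; module_eq_with ltac:(try (field; lra))).
eapply Rle_trans; [apply (norm_scal (K := R_AbsRing) (V := V))|].
change (abs (/ d)) with (Rabs (/ d)).
assert (Hid : 0 < / d) by (apply Rinv_0_lt_compat, Hd).
rewrite Rabs_pos_eq by lra.
replace ((B (s0 + d) - B (s0 - d)) / (2 * d)) with (/ d * ((B (s0 + d) - B (s0 - d)) / 2)) by (field; lra).
apply Rmult_le_compat_l; lra.
Qed.
End Averaging.

(** * Integration by parts against a polynomial weight *)

Lemma pow_plus_ge X h n : 0 <= X -> 0 <= h -> X ^ S n + INR (S n) * h * X ^ n <= (X + h) ^ S n.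
Proof.
intros HX Hh. induction n as [|n IH]; [simpl; lra|].
apply Rle_trans with ((X + h) * (X ^ S n + INR (S n) * h * X ^ n)).
- rewrite (S_INR (S n)). simpl (X ^ S (S n)). simpl (X ^ S n).
  pose proof (pow_le X n HX). pose proof (pos_INR (S n)).
  assert (0 <= INR (S n) * h * h * X ^ n) by (repeat apply Rmult_le_pos; assumption).
  nra.
- change ((X + h) ^ S (S n)) with ((X + h) * (X + h) ^ S n).
  apply Rmult_le_compat_l; lra.
Qed.

(** Bound for the boundary terms at [0] of the full integration by parts of
    [x ^ a * (N - x) ^ b] against an orbit. Only derivatives of order at least [a]
    survive there; the leading one gives [a! m ^ a N ^ b], and the later ones are
    absorbed by enlarging [N] to [N + (a + b) m]. *)
Definition end_bound (m N : R) (a b : nat) : R :=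
  INR (fact a) * m ^ a * (N + INR (a + b) * m) ^ b.

Lemma end_bound_ge0 m N a b : 0 <= m -> 0 <= N -> 0 <= end_bound m N a b.
Proof.
intros Hm HN. unfold end_bound.
repeat apply Rmult_le_pos; try apply pow_le; try apply pos_INR; try assumption.
apply Rplus_le_le_0_compat; [assumption|]. apply Rmult_le_pos; [apply pos_INR|assumption].
Qed.

(** One integration by parts leaves the three terms on the left: the boundary term
    itself, and the two terms of the derivative of the weight. *)
Lemma end_bound_rec m N a b : 0 <= m -> 0 <= N ->
  0 ^ a * N ^ b + INR a * m * end_bound m N (pred a) b + INR b * m * end_bound m N a (pred b)
    <= end_bound m N a b.
Proof.
intros Hm HN. unfold end_bound.
assert (HX : forall c, 0 <= N + INR c * m).
{ intros c. apply Rplus_le_le_0_compat; [assumption|]. apply Rmult_le_pos; [apply pos_INR|assumption]. }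
destruct a as [|a]; destruct b as [|b]; simpl pred.
- simpl. lra.
- rewrite !Nat.add_0_l, pow_O. simpl (fact 0). change (INR 0) with 0. change (INR 1) with 1.
  pose proof (pow_plus_ge (N + INR b * m) m b (HX b) Hm) as H.
  replace (N + INR b * m + m) with (N + INR (S b) * m) in H by (rewrite S_INR; ring).
  pose proof (pow_incr N (N + INR b * m) (S b)) as H1.
  assert (N <= N + INR b * m) by (pose proof (Rmult_le_pos _ _ (pos_INR b) Hm); lra).
  specialize (H1 (conj HN H0)). lra.
- rewrite !Nat.add_0_r. rewrite fact_simpl, mult_INR. change (INR 0) with 0. simpl pow. right. ring.
- replace (S a + b)%nat with (a + S b)%nat by lia.
  replace (S a + S b)%nat with (S (a + S b)) by lia.
  pose proof (pow_plus_ge (N + INR (a + S b) * m) m b (HX _) Hm) as H.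
  replace (N + INR (a + S b) * m + m) with (N + INR (S (a + S b)) * m) in H
    by (rewrite (S_INR (a + S b)); ring).
  rewrite fact_simpl, mult_INR.
  apply (Rmult_le_compat_l (INR (S a) * INR (fact a) * m ^ S a)) in H;
    [|repeat apply Rmult_le_pos; try apply pow_le; try apply pos_INR; assumption].
  eapply Rle_trans; [|exact H]. right. simpl pow. ring.
Qed.

Lemma is_derive_weight (N : R) a b x :
  is_derive (fun x => x ^ a * (N - x) ^ b) x
    (INR a * (x ^ pred a * (N - x) ^ b) - INR b * (x ^ a * (N - x) ^ pred b)).
Proof. auto_derive; [trivial|]. unfold Rminus. ring. Qed.

Section Weight.
(* To be used with [E x = exp (i s (t - x)) T(x)] and [Q] the resolvent at [i s]; then
   [HE] says that [- E x (Q z)] is a primitive of [E x z]. *)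
Variables (V : CompleteNormedModule R_AbsRing) (E : R -> V -> V) (Q : V -> V) (K m N : R).
Hypothesis HK : 0 <= K.
Hypothesis Hm : 0 <= m.
Hypothesis HN : 0 <= N.
Hypothesis HE : forall z x, 0 <= x <= N -> is_derive (fun x => E x (Q z)) x (opp (E x z)).
Hypothesis HEc : forall z x, 0 <= x <= N -> continuous (fun x => E x z) x.
Hypothesis HE0 : forall z, norm (E 0 z) <= K * norm z.
Hypothesis HEN : forall z, norm (E N z) <= K * norm z.
Hypothesis HQ : forall z, norm (Q z) <= m * norm z.

(** Integrating by parts until the weight is used up produces a primitive. Its values
    at both ends involve [Q] at least [a + 1] and [b + 1] times, respectively, since
    the weight vanishes there to that order. *)
Lemma weight_primitive n : forall a b z, (a + b <= n)%nat -> exists G : R -> V,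
  (forall x, 0 <= x <= N -> is_derive G x (scal (x ^ a * (N - x) ^ b) (E x z))) /\
  norm (G 0) <= K * end_bound m N a b * norm (Q z) /\
  norm (G N) <= K * end_bound m N b a * norm (Q z).
Proof.
induction n as [n IH] using Wf_nat.lt_wf_ind. intros a b z Hab.
assert (Hsub : forall c a' b', (c = 0 \/ a' + b' < n)%nat -> exists G : R -> V,
  (forall x, 0 <= x <= N -> is_derive G x (scal (INR c) (scal (x ^ a' * (N - x) ^ b') (E x (Q z))))) /\
  norm (G 0) <= K * (INR c * m * end_bound m N a' b') * norm (Q z) /\
  norm (G N) <= K * (INR c * m * end_bound m N b' a') * norm (Q z)).
{ intros c a' b' [->|Hlt].
  - exists (fun _ => zero). split; [|split].
    + intros x _. change (INR 0) with 0.
      replace (scal 0 _) with (zero : V) by (symmetry; apply (scal_zero_l (K := R_Ring) (V := V))).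
      apply (is_derive_const (V := V)).
    + eapply Rle_trans; [right; apply norm_zero_eq|]. change (INR 0) with 0. right; ring.
    + eapply Rle_trans; [right; apply norm_zero_eq|]. change (INR 0) with 0. right; ring.
  - destruct (IH (a' + b')%nat Hlt a' b' (Q z) (le_n _)) as (G & HG & H0 & H1).
    assert (Hc := pos_INR c).
    assert (HB : forall X e, 0 <= e -> X <= K * e * norm (Q (Q z)) ->
       INR c * X <= K * (INR c * m * e) * norm (Q z)).
    { intros X e He HX. apply Rle_trans with (INR c * (K * e * (m * norm (Q z)))).
      - apply Rmult_le_compat_l; [exact Hc|]. eapply Rle_trans; [exact HX|].
        apply Rmult_le_compat_l; [apply Rmult_le_pos; assumption|]. apply HQ.
      - right; ring. }
    exists (fun x => scal (INR c) (G x)). split; [|split].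
    + intros x Hx. evar_last.
      * apply (is_derive_scal_fct (fun _ => INR c) G x 0 _ (is_derive_const (INR c) x) (HG x Hx)).
      * module_eq.
    + eapply Rle_trans; [apply norm_scal_le|].
      rewrite Rabs_pos_eq by exact Hc.
      apply HB; [apply end_bound_ge0; assumption|exact H0].
    + eapply Rle_trans; [apply norm_scal_le|].
      rewrite Rabs_pos_eq by exact Hc.
      apply HB; [apply end_bound_ge0; assumption|exact H1]. }
destruct (Hsub a (pred a) b) as (G1 & HG1 & H10 & H1N); [lia|].
destruct (Hsub b a (pred b)) as (G2 & HG2 & H20 & H2N); [lia|].
pose (w := fun x => x ^ a * (N - x) ^ b).
assert (Htri : forall x y v e1 e2 e3, norm x <= e1 -> norm y <= e2 -> norm v <= e3 ->
  norm (minus (minus x y) v : V) <= e1 + e2 + e3).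
{ intros x y v e1 e2 e3 h1 h2 h3. eapply Rle_trans; [apply norm_minus_le|].
  apply Rplus_le_compat; [|exact h3].
  eapply Rle_trans; [apply norm_minus_le|]. apply Rplus_le_compat; assumption. }
assert (Hw : forall x e, 0 <= w x -> norm (E x (Q z)) <= K * norm (Q z) -> w x <= e ->
   norm (scal (w x) (E x (Q z))) <= K * e * norm (Q z)).
{ intros x e h0 h1 h2. eapply Rle_trans; [apply norm_scal_le|].
  rewrite Rabs_pos_eq by exact h0.
  apply Rle_trans with (e * (K * norm (Q z))); [|right; ring].
  apply Rmult_le_compat; try assumption. apply norm_ge_0. }
(* [G1] and [G2] integrate the two terms of [w'] against [E x (Q z)]. *)
exists (fun x => minus (minus (G1 x) (G2 x)) (scal (w x) (E x (Q z)))). split; [|split].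
- intros x Hx. evar_last.
  + apply (is_derive_minus (V := V) (fun x => minus (G1 x) (G2 x)) (fun x => scal (w x) (E x (Q z)))).
    * apply (is_derive_minus (V := V) G1 G2); [apply HG1, Hx|apply HG2, Hx].
    * apply (is_derive_scal_fct w (fun x => E x (Q z))); [apply is_derive_weight|apply HE, Hx].
  + unfold w. module_eq.
- apply Rle_trans with (K * (INR a * m * end_bound m N (pred a) b) * norm (Q z)
     + K * (INR b * m * end_bound m N a (pred b)) * norm (Q z) + K * (0 ^ a * N ^ b) * norm (Q z)).
  + apply Htri; [exact H10|exact H20|]. apply Hw; [|apply HE0|]; unfold w; rewrite Rminus_0_r.
    * apply Rmult_le_pos; apply pow_le; lra.
    * lra.
  + pose proof (end_bound_rec m N a b Hm HN) as H.
    apply (Rmult_le_compat_l (K * norm (Q z))) in H; [|apply Rmult_le_pos; [exact HK|apply norm_ge_0]].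
    lra.
- apply Rle_trans with (K * (INR a * m * end_bound m N b (pred a)) * norm (Q z)
     + K * (INR b * m * end_bound m N (pred b) a) * norm (Q z) + K * (0 ^ b * N ^ a) * norm (Q z)).
  + apply Htri; [exact H1N|exact H2N|]. apply Hw; [|apply HEN|]; unfold w; rewrite Rminus_diag.
    * apply Rmult_le_pos; apply pow_le; lra.
    * lra.
  + pose proof (end_bound_rec m N b a Hm HN) as H.
    apply (Rmult_le_compat_l (K * norm (Q z))) in H; [|apply Rmult_le_pos; [exact HK|apply norm_ge_0]].
    lra.
Qed.

Lemma norm_weight_integral_le k z :
  norm (RInt (fun x => scal (x ^ k * (N - x) ^ k) (E x z)) 0 N)
    <= 2 * K * end_bound m N k k * norm (Q z).
Proof.
destruct (weight_primitive (k + k) k k z (le_n _)) as (G & HG & H0 & H1).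
rewrite (is_RInt_unique (V := V) _ 0 N (minus (G N) (G 0))).
- eapply Rle_trans; [apply norm_minus_le|]. lra.
- apply (is_RInt_derive (V := V) G); rewrite Rmin_left, Rmax_right by exact HN; [exact HG|].
  intros x Hx. apply (continuous_scal (fun x => x ^ k * (N - x) ^ k) (fun x => E x z)); [|apply HEc, Hx].
  apply continuity_pt_filterlim. apply derivable_continuous_pt.
  eexists. apply is_derive_Reals. apply is_derive_weight.
Qed.
End Weight.

(** * Numerical estimates *)

Lemma exp_INR_mult x k : exp (INR k * x) = exp x ^ k.
Proof.
induction k as [|k IH]; [simpl; rewrite Rmult_0_l; apply exp_0|].
rewrite S_INR, Rmult_plus_distr_r, Rmult_1_l, exp_plus, IH. simpl. ring.
Qed.

(** A weak form of Stirling's formula; the factor [exp (- k)] is what produces the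
    decay, so that a bound by [k ^ k] would not do. *)
Lemma fact_le_pow k : (1 <= k)%nat ->
  INR (fact k) <= exp 1 * INR k * (INR k ^ k * exp (- INR k)).
Proof.
induction k as [|k IH]; [lia|]. intros _.
destruct k as [|k].
- change (INR (fact 1)) with 1. change (INR 1) with 1.
  replace (exp 1 * 1 * (1 ^ 1 * exp (- (1)))) with (exp 1 * exp (- (1))) by ring.
  rewrite <- exp_plus, Rplus_opp_r, exp_0. lra.
- specialize (IH ltac:(lia)). set (j := S k) in *.
  assert (Hj : 0 < INR j) by (apply lt_0_INR; unfold j; lia).
  rewrite fact_simpl, mult_INR, S_INR.
  set (x := INR j) in *.
  assert (H : x ^ S j * exp (- x) <= (x + 1) ^ S j * exp (- (x + 1))).
  { (* (x / (x + 1)) ^ (x + 1) <= exp (- 1), from 1 - y <= exp (- y) at y = 1 / (x + 1) *)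
    assert (H1 : x / (x + 1) <= exp (- / (x + 1))).
    { pose proof (exp_ineq1_le (- / (x + 1))). replace (x / (x + 1)) with (1 + - / (x + 1)) by (field; lra). lra. }
    assert (H2 : (x / (x + 1)) ^ S j <= exp (-1)).
    { replace (-1) with (INR (S j) * - / (x + 1)) by (rewrite S_INR; fold x; field; lra).
      rewrite exp_INR_mult. apply pow_incr. split; [|exact H1].
      apply Rlt_le, Rdiv_lt_0_compat; lra. }
    replace (x ^ S j) with ((x / (x + 1)) ^ S j * (x + 1) ^ S j)
      by (rewrite <- Rpow_mult_distr; f_equal; field; lra).
    replace (- (x + 1)) with (-1 + - x) by ring. rewrite exp_plus.
    assert (0 < (x + 1) ^ S j) by (apply pow_lt; lra). pose proof (exp_pos (- x)).
    apply Rle_trans with (exp (-1) * ((x + 1) ^ S j * exp (- x))); [|right; ring].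
    rewrite Rmult_assoc. apply Rmult_le_compat_r; [|exact H2].
    apply Rmult_le_pos; lra. }
  apply Rle_trans with ((x + 1) * (exp 1 * (x ^ S j * exp (- x)))).
  + apply Rmult_le_compat_l; [lra|]. eapply Rle_trans; [exact IH|]. simpl pow. right; ring.
  + apply Rle_trans with ((x + 1) * (exp 1 * ((x + 1) ^ S j * exp (- (x + 1))))); [|right; ring].
    apply Rmult_le_compat_l; [lra|]. apply Rmult_le_compat_l; [|exact H].
    apply Rlt_le, exp_pos.
Qed.

(** On an interval of length [L t], the boundary terms divided by the value of the
    weight at [t] are about [k! (m / t) ^ k], hence exponentially small in [k] as long
    as [k m <= t]; the loss [((L + 2) / (L - 1)) ^ k] has a base that tends to [1] as
    [L] grows. *)
Lemma end_bound_ratio m t L k : 0 < m -> 0 < t -> 1 < L -> (1 <= k)%nat -> INR k * m <= t ->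
  end_bound m (L * t) k k / (t * (L * t - t)) ^ k
    <= exp 1 * INR k * (exp (- INR k) * ((L + 2) / (L - 1)) ^ k).
Proof.
intros Hm Ht HL Hk Hkm.
assert (Hk0 := pos_INR k). pose proof (exp_pos 1). pose proof (exp_pos (- INR k)).
assert (HLt : 0 < L * t - t) by nra.
assert (Hden : 0 < (t * (L * t - t)) ^ k) by (apply pow_lt; apply Rmult_lt_0_compat; lra).
apply Rle_trans with ((exp 1 * INR k * (INR k ^ k * exp (- INR k))) * m ^ k * ((L + 2) * t) ^ k / (t * (L * t - t)) ^ k).
- apply Rmult_le_compat_r; [apply Rlt_le, Rinv_0_lt_compat, Hden|].
  unfold end_bound. rewrite plus_INR.
  apply Rmult_le_compat.
  + apply Rmult_le_pos; [apply pos_INR|apply pow_le; lra].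
  + apply pow_le. nra.
  + apply Rmult_le_compat_r; [apply pow_le; lra|]. apply fact_le_pow, Hk.
  + apply pow_incr. split; nra.
- replace (exp 1 * INR k * (INR k ^ k * exp (- INR k)) * m ^ k * ((L + 2) * t) ^ k / (t * (L * t - t)) ^ k)
    with (exp 1 * INR k * (exp (- INR k) * ((L + 2) / (L - 1)) ^ k) * (INR k * m / t) ^ k).
  + rewrite <- (Rmult_1_r (exp 1 * INR k * (exp (- INR k) * ((L + 2) / (L - 1)) ^ k))) at 2.
    apply Rmult_le_compat_l.
    * repeat apply Rmult_le_pos; try lra. apply pow_le. apply Rlt_le, Rdiv_lt_0_compat; lra.
    * rewrite <- (pow1 k). apply pow_incr. split.
      -- apply Rmult_le_pos; [nra|apply Rlt_le, Rinv_0_lt_compat, Ht].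
      -- apply (Rmult_le_reg_r t); [exact Ht|]. unfold Rdiv. rewrite Rmult_assoc, Rinv_l; lra.
  + replace (t * (L * t - t)) with (t * t * (L - 1)) by ring.
    unfold Rdiv. rewrite <- pow_inv.
    transitivity (exp 1 * INR k * exp (- INR k) * (((L + 2) * / (L - 1)) ^ k * (INR k * m * / t) ^ k)); [ring|].
    transitivity (exp 1 * INR k * exp (- INR k) *
      (INR k ^ k * m ^ k * ((L + 2) * t) ^ k * (/ (t * t * (L - 1))) ^ k)); [|ring].
    f_equal. rewrite <- !Rpow_mult_distr. f_equal. field. lra.
Qed.

Lemma pow_sub_1_le rho h k : 0 <= rho -> Rabs (rho - 1) <= h -> Rabs (rho ^ k - 1) <= INR k * h * (1 + h) ^ k.
Proof.
intros Hr Hh. assert (Hh0 : 0 <= h) by (pose proof (Rabs_pos (rho - 1)); lra).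
induction k as [|k IH]; [simpl; rewrite Rminus_diag, Rabs_R0; lra|].
replace (rho ^ S k - 1) with (rho * (rho ^ k - 1) + (rho - 1)) by (simpl; ring).
eapply Rle_trans; [apply Rabs_triang|]. rewrite Rabs_mult, (Rabs_pos_eq rho Hr), S_INR. simpl pow.
assert (rho <= 1 + h) by (apply Rabs_le_between in Hh; lra).
assert (1 <= (1 + h) ^ k) by (apply pow_R1_Rle; lra).
pose proof (Rabs_pos (rho ^ k - 1)). pose proof (pos_INR k).
assert (rho * Rabs (rho ^ k - 1) <= (1 + h) * (INR k * h * (1 + h) ^ k)) by (apply Rmult_le_compat; lra).
assert (h * 1 <= h * ((1 + h) * (1 + h) ^ k)) by (apply Rmult_le_compat_l; [lra|nra]).
lra.
Qed.

(** Normalised to have the value [1] at [t]. *)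
Definition weight (k : nat) (N t x : R) : R := (x ^ k * (N - x) ^ k) / (t * (N - t)) ^ k.

Lemma weight_near k t L x : 0 < t -> 2 <= L -> 0 <= x <= L * t ->
  Rabs (weight k (L * t) t x - 1)
    <= INR k * (2 * Rabs (t - x) / t) * (1 + 2 * Rabs (t - x) / t) ^ k.
Proof.
intros Ht HL Hx.
assert (HLt : t <= L * t - t) by nra.
assert (Hden : 0 < t * (L * t - t)) by (apply Rmult_lt_0_compat; lra).
unfold weight. rewrite <- Rpow_mult_distr. unfold Rdiv at 1. rewrite <- pow_inv, <- Rpow_mult_distr.
apply pow_sub_1_le.
- apply Rmult_le_pos; [apply Rmult_le_pos; lra|]. apply Rlt_le, Rinv_0_lt_compat, Hden.
- replace (x * (L * t - x) * / (t * (L * t - t)) - 1) with ((t - x) * ((x + t - L * t) / (t * (L * t - t)))) by (field; nra).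
  rewrite Rabs_mult. apply Rle_trans with (Rabs (t - x) * (2 / t)); [|right; field; lra].
  apply Rmult_le_compat_l; [apply Rabs_pos|].
  unfold Rdiv. rewrite Rabs_mult, (Rabs_pos_eq (/ _)) by (apply Rlt_le, Rinv_0_lt_compat, Hden).
  apply (Rmult_le_reg_r (t * (L * t - t))); [exact Hden|].
  rewrite Rmult_assoc, Rinv_l, Rmult_1_r by lra.
  replace (2 * / t * (t * (L * t - t))) with (2 * (L * t - t)) by (field; lra).
  apply Rabs_le. split; nra.
Qed.

(** The weight is within a bounded multiple of [|t - x| / m] of [1] on the scale [m]
    around [t]. Further away it may be as large as [(1 + 2 L) ^ k], but this is at
    most a fixed power of [R0 m], and so of [R0 |t - x|], which a kernel that decays
    fast enough can absorb. *)
Lemma weight_deviation k t L x m R0 r : 0 < t -> 2 <= L -> 0 <= x <= L * t ->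
  0 < m -> INR k * m <= t -> 0 < R0 -> (1 + 2 * L) ^ k <= (R0 * m) ^ r ->
  Rabs (weight k (L * t) t x - 1)
    <= 2 / m * Rabs (t - x) * (exp 2 + (R0 * Rabs (t - x)) ^ r).
Proof.
intros Ht HL Hx Hm Hkm HR Hr.
pose proof (Rabs_pos (t - x)) as Hv. set (v := Rabs (t - x)) in *.
assert (Hvt : 0 <= v / t) by (apply Rmult_le_pos; [exact Hv|apply Rlt_le, Rinv_0_lt_compat, Ht]).
eapply Rle_trans; [apply weight_near; assumption|]. fold v.
assert (HP1 : 1 <= (1 + 2 * v / t) ^ k) by (apply pow_R1_Rle; lra).
assert (HRv : 0 <= (R0 * v) ^ r) by (apply pow_le; nra).
pose proof (exp_pos 2). pose proof (pos_INR k).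
apply Rmult_le_compat; [nra|lra| |].
- apply (Rmult_le_reg_r t); [exact Ht|]. apply (Rmult_le_reg_r m); [exact Hm|].
  replace (INR k * (2 * v / t) * t * m) with (2 * v * (INR k * m)) by (field; lra).
  replace (2 / m * v * t * m) with (2 * v * t) by (field; lra). nra.
- destruct (Rle_dec v m) as [Hvm|Hvm].
  + apply Rle_trans with (exp 2); [|lra].
    replace 2 with (INR k * m / t * 2 + (1 - INR k * m / t) * 2) at 2 by ring.
    apply Rle_trans with (exp (INR k * (2 * v / t))).
    * rewrite exp_INR_mult. apply pow_incr. split; [lra|]. apply exp_ineq1_le.
    * assert (INR k * (2 * v / t) <= INR k * m / t * 2 + (1 - INR k * m / t) * 2).
      { replace (INR k * m / t * 2 + (1 - INR k * m / t) * 2) with 2 by ring.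
        apply (Rmult_le_reg_r t); [exact Ht|].
        replace (INR k * (2 * v / t) * t) with (2 * (INR k * v)) by (field; lra). nra. }
      destruct H1 as [H1|H1]; [left; apply exp_increasing, H1|right; rewrite H1; reflexivity].
  + apply Rle_trans with ((R0 * m) ^ r); [|].
    * eapply Rle_trans; [|exact Hr]. apply pow_incr. split; [lra|].
      apply Rplus_le_compat_l. apply (Rmult_le_reg_r t); [exact Ht|].
      replace (2 * v / t * t) with (2 * v) by (field; lra).
      assert (v <= L * t); [|nra]. unfold v. apply Rabs_le. split; nra.
    * apply Rle_trans with ((R0 * v) ^ r); [|lra]. apply pow_incr. split; nra.
Qed.

(** [n] factors [sinc] decay like [|x| ^ (- n)], which compensates the growth
    [|x| ^ (r + 1)] of the deviation of the weight and leaves an integrable function. *)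
Lemma sinc_kernel_bound n r b1 b2 x : 0 <= b1 -> 0 <= b2 -> (r + 3 <= n)%nat ->
  Rabs (sinc x) ^ n * (Rabs x * (b1 + b2 * Rabs x ^ r)) <= 2 * (b1 + b2) / (1 + x ^ 2).
Proof.
intros H1 H2 Hn.
pose proof (pow2_ge_0 x). pose proof (Rabs_pos x) as Hx. pose proof (Rabs_pos (sinc x)) as Hs.
apply (Rmult_le_reg_r (1 + x ^ 2)); [lra|].
replace (2 * (b1 + b2) / (1 + x ^ 2) * (1 + x ^ 2)) with (2 * (b1 + b2)) by (field; lra).
rewrite <- (pow2_abs x) in *. set (a := Rabs x) in *.
assert (Hsn : forall j, 0 <= Rabs (sinc x) ^ j <= 1).
{ intros j. split; [apply pow_le, Hs|]. rewrite <- (pow1 j). apply pow_incr. split; [exact Hs|apply Rabs_sinc_le1]. }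
assert (Har : 0 <= a ^ r) by (apply pow_le, Hx).
destruct (Rle_dec a 1) as [Ha|Ha].
- assert (a ^ r <= 1) by (rewrite <- (pow1 r); apply pow_incr; lra).
  assert (0 <= b1 + b2 * a ^ r <= b1 + b2) by (split; nra).
  assert (0 <= a * (b1 + b2 * a ^ r) <= b1 + b2) by (split; nra).
  assert (Rabs (sinc x) ^ n * (a * (b1 + b2 * a ^ r)) <= b1 + b2) by (pose proof (Hsn n); nra).
  assert (0 <= Rabs (sinc x) ^ n * (a * (b1 + b2 * a ^ r))) by (apply Rmult_le_pos; [apply Hsn|lra]).
  rewrite (Rmult_comm 2). apply Rmult_le_compat; [assumption|lra|assumption|nra].
- assert (Ha1 : 1 <= a) by lra.
  assert (Hsa : a * Rabs (sinc x) <= 1).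
  { unfold a. rewrite <- Rabs_mult, sinc_mult. apply Rabs_sin_le1. }
  assert (Hsr : a ^ (r + 3) * Rabs (sinc x) ^ (r + 3) <= 1).
  { rewrite <- Rpow_mult_distr. rewrite <- (pow1 (r + 3)). apply pow_incr. split; [nra|exact Hsa]. }
  assert (H3 : Rabs (sinc x) ^ n <= Rabs (sinc x) ^ (r + 3)).
  { replace n with (r + 3 + (n - (r + 3)))%nat by lia. rewrite pow_add.
    pose proof (Hsn (r + 3)%nat). pose proof (Hsn (n - (r + 3))%nat). nra. }
  assert (H4 : a * (b1 + b2 * a ^ r) * (1 + a ^ 2) <= 2 * (b1 + b2) * a ^ (r + 3)).
  { assert (1 <= a ^ r) by (apply pow_R1_Rle, Ha1).
    replace (a ^ (r + 3)) with (a ^ r * (a * a ^ 2)) by (rewrite pow_add; simpl; ring).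
    assert (1 + a ^ 2 <= 2 * a ^ 2) by nra.
    assert (b1 + b2 * a ^ r <= (b1 + b2) * a ^ r) by nra.
    apply Rle_trans with (a * ((b1 + b2) * a ^ r) * (2 * a ^ 2)); [|right; ring].
    assert (0 <= b1 + b2 * a ^ r) by (pose proof (Rmult_le_pos _ _ H2 Har); lra).
    apply Rmult_le_compat; [apply Rmult_le_pos; lra|nra| |assumption]. apply Rmult_le_compat_l; lra. }
  apply Rle_trans with (Rabs (sinc x) ^ (r + 3) * (2 * (b1 + b2) * a ^ (r + 3))).
  + rewrite Rmult_assoc. apply Rmult_le_compat; [apply Hsn| |exact H3|exact H4].
    repeat apply Rmult_le_pos; try lra. pose proof (Rmult_le_pos _ _ H2 Har); lra.
  + apply Rle_trans with (2 * (b1 + b2) * (a ^ (r + 3) * Rabs (sinc x) ^ (r + 3))); [right; ring|].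
    rewrite <- (Rmult_1_r (2 * (b1 + b2))) at 2. apply Rmult_le_compat_l; lra.
Qed.

Lemma arcsinh_odd x : arcsinh (- x) = - arcsinh x.
Proof.
rewrite <- (arcsinh_sinh (- arcsinh x)). f_equal.
unfold sinh. rewrite Ropp_involutive.
rewrite <- (sinh_arcsinh x) at 1. unfold sinh. field.
Qed.

Lemma arcsinh_le_ln x : 0 <= x -> arcsinh x <= ln (2 * x + 1).
Proof.
intros Hx. unfold arcsinh. apply ln_le.
- pose proof (sqrt_lt_R0 (x ^ 2 + 1)). pose proof (pow2_ge_0 x). lra.
- assert (sqrt (x ^ 2 + 1) <= x + 1); [|lra].
  rewrite <- (sqrt_pow2 (x + 1)) by lra. apply sqrt_le_1_alt. nra.
Qed.

Lemma sqr_exp_le x e : 0 < e -> 0 <= x -> x ^ 2 * exp (- (e * x)) <= 4 / e ^ 2.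
Proof.
intros He Hx. 
assert (H : e * x / 2 <= exp (e * x / 2)) by (pose proof (exp_ineq1_le (e * x / 2)); lra).
assert (H2 : (e * x / 2) ^ 2 <= exp (e * x)).
{ replace (e * x) with (INR 2 * (e * x / 2)) at 2 by (simpl; field). rewrite exp_INR_mult.
  apply pow_incr. split; [nra|exact H]. }
rewrite exp_Ropp. pose proof (exp_pos (e * x)).
apply (Rmult_le_reg_r (exp (e * x))); [assumption|].
rewrite Rmult_assoc, Rinv_l, Rmult_1_r by lra.
apply (Rmult_le_reg_l (e ^ 2 / 4)); [apply Rdiv_lt_0_compat; nra|].
replace (e ^ 2 / 4 * (4 / e ^ 2 * exp (e * x))) with (exp (e * x)) by (field; lra).
eapply Rle_trans; [|exact H2]. right; field.
Qed.

(** The loss in [end_bound_ratio] can have any base larger than [1], at the price of a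
    long interval; the base chosen here costs half of the gap between [c] and [1]. *)
Lemma ratio_limit c : c < 1 -> exists L, 2 <= L /\ (L + 2) / (L - 1) <= exp ((1 - c) / 2).
Proof.
intros Hc. set (e := (1 - c) / 2). assert (He : 0 < e) by (unfold e; lra).
exists (2 + 3 / e). assert (H3 : 0 < 3 / e) by (apply Rdiv_lt_0_compat; lra).
split; [lra|]. eapply Rle_trans; [|apply exp_ineq1_le].
apply (Rmult_le_reg_r (2 + 3 / e - 1)); [lra|].
replace ((2 + 3 / e + 2) / (2 + 3 / e - 1) * (2 + 3 / e - 1)) with (4 + 3 / e) by (field; lra).
assert (e * (3 / e) = 3) by (field; lra). nra.
Qed.

(** With [lam = ln (R0 m)] and [k] close to [lam / c], the factor [exp (- k)] beats
    [R0 m = exp lam] by the margin [exp (- e lam)], [e = (1 - c) / (2 c)]; half of the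
    gap between [c] and [1] is spent on the ratio [(L + 2) / (L - 1)]. The margin
    absorbs the two factors [k] and [arcsinh R0], each of order at most [lam]. *)
Lemma decay_numeric c M0 m R0 k L : 0 < c < 1 -> 0 < M0 <= m -> 1 <= R0 -> 2 <= L ->
  (L + 2) / (L - 1) <= exp ((1 - c) / 2) -> 1 <= ln (R0 * m) ->
  INR k <= ln (R0 * m) / c <= INR k + 1 ->
  m * (exp 1 * INR k * (exp (- INR k) * ((L + 2) / (L - 1)) ^ k)) * arcsinh R0
    <= exp 1 * (exp 1 / c) * (1 + Rabs (ln (3 / M0))) * (4 / ((1 - c) / (2 * c)) ^ 2) / R0.
Proof.
intros [Hc0 Hc1] [HM0 Hm] HR HL Hq Hlam [Hk1 Hk2].
set (lam := ln (R0 * m)) in *. set (e := (1 - c) / (2 * c)).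
assert (He : 0 < e) by (apply Rdiv_lt_0_compat; lra).
assert (HRm : exp lam = R0 * m) by (apply exp_ln; nra).
assert (Has : 0 <= arcsinh R0 <= lam * (1 + Rabs (ln (3 / M0)))).
{ split. { rewrite <- arcsinh_0. apply arcsinh_le; lra. }
  eapply Rle_trans; [apply arcsinh_le_ln; lra|].
  apply Rle_trans with (ln (3 / M0 * (R0 * m))).
  - apply ln_le; [lra|]. apply Rle_trans with (3 * R0); [lra|].
    apply (Rmult_le_reg_r M0); [lra|]. replace (3 / M0 * (R0 * m) * M0) with (3 * R0 * m) by (field; lra). nra.
  - rewrite ln_mult; [|apply Rdiv_lt_0_compat; lra|nra]. fold lam.
    pose proof (Rle_abs (ln (3 / M0))). pose proof (Rabs_pos (ln (3 / M0))). nra. }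
assert (Hp : R0 * m * (exp (- INR k) * ((L + 2) / (L - 1)) ^ k) <= exp 1 * exp (- (e * lam))).
{ rewrite <- HRm.
  apply Rle_trans with (exp lam * (exp (- INR k) * exp (INR k * ((1 - c) / 2)))).
  - apply Rmult_le_compat_l; [apply Rlt_le, exp_pos|].
    apply Rmult_le_compat_l; [apply Rlt_le, exp_pos|].
    rewrite exp_INR_mult. apply pow_incr. split; [|exact Hq].
    apply Rlt_le, Rdiv_lt_0_compat; lra.
  - rewrite <- !exp_plus.
    assert (H : lam + (- INR k + INR k * ((1 - c) / 2)) <= 1 + - (e * lam)).
    { replace (- INR k + INR k * ((1 - c) / 2)) with (- (INR k * ((1 + c) / 2))) by field.
      assert (lam / c - 1 <= INR k) by lra.
      assert ((lam / c - 1) * ((1 + c) / 2) <= INR k * ((1 + c) / 2)) by (apply Rmult_le_compat_r; lra).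
      assert ((lam / c - 1) * ((1 + c) / 2) = lam + e * lam - (1 + c) / 2) by (unfold e; field; lra). lra. }
    destruct H as [H|H]; [left; apply exp_increasing, H|right; rewrite H; reflexivity]. }
apply (Rmult_le_reg_r R0); [lra|].
assert (HA : 0 <= 1 + Rabs (ln (3 / M0))) by (pose proof (Rabs_pos (ln (3 / M0))); lra).
set (A := 1 + Rabs (ln (3 / M0))) in *.
replace (exp 1 * (exp 1 / c) * A * (4 / e ^ 2) / R0 * R0) with (exp 1 * (exp 1 / c) * A * (4 / e ^ 2)) by (field; lra).
replace (m * (exp 1 * INR k * (exp (- INR k) * ((L + 2) / (L - 1)) ^ k)) * arcsinh R0 * R0)
  with (exp 1 * (INR k * ((R0 * m * (exp (- INR k) * ((L + 2) / (L - 1)) ^ k)) * arcsinh R0))) by ring.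
apply Rle_trans with (exp 1 * (lam / c * (exp 1 * exp (- (e * lam)) * (lam * A)))).
- apply Rmult_le_compat_l; [apply Rlt_le, exp_pos|].
  assert (0 <= R0 * m * (exp (- INR k) * ((L + 2) / (L - 1)) ^ k)).
  { apply Rmult_le_pos; [nra|]. apply Rmult_le_pos; [apply Rlt_le, exp_pos|].
    apply pow_le. apply Rlt_le, Rdiv_lt_0_compat; lra. }
  apply Rmult_le_compat; [apply pos_INR|apply Rmult_le_pos; lra|exact Hk1|].
  apply Rmult_le_compat; lra.
- replace (exp 1 * (lam / c * (exp 1 * exp (- (e * lam)) * (lam * A))))
    with (exp 1 * (exp 1 / c) * A * (lam ^ 2 * exp (- (e * lam)))) by (field; lra).
  apply Rmult_le_compat_l; [|apply sqr_exp_le; lra].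
  pose proof (exp_pos 1). apply Rmult_le_pos; [|exact HA]. apply Rmult_le_pos; [lra|].
  apply Rlt_le, Rdiv_lt_0_compat; lra.
Qed.

(** * The smoothing kernel *)

Lemma continuous_affine (d t x : R) : continuous (fun x : R => d * (t - x)) x.
Proof. apply continuity_pt_filterlim. apply derivable_continuous_pt. reg. Qed.

Lemma continuous_sinc_pow (d t : R) n x : continuous (fun x : R => sinc (d * (t - x)) ^ n) x.
Proof.
apply (continuous_comp (fun x => sinc (d * (t - x))) (fun y => y ^ n)).
- apply (continuous_comp (fun x => d * (t - x)) sinc); [apply continuous_affine|apply continuous_sinc].
- apply continuity_pt_filterlim. apply derivable_continuous_pt. reg.
Qed.

Lemma ex_RInt_cont {V : CompleteNormedModule R_AbsRing} (f : R -> V) a b :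
  (forall x, continuous f x) -> ex_RInt f a b.
Proof. intros H. apply ex_RInt_continuous. intros x _. apply H. Qed.

Lemma kernel_mass n d t N : 0 < d -> 1 <= 2 * d * t -> t <= N -> Nat.Even n ->
  (1 / 2) ^ n / (2 * d) <= RInt (fun x => sinc (d * (t - x)) ^ n) 0 N.
Proof.
intros Hd Ht HN [j ->].
set (f := fun x => sinc (d * (t - x)) ^ (2 * j)).
assert (Hf : forall x, continuous f x) by (intros; apply continuous_sinc_pow).
assert (Hex : forall a b, ex_RInt f a b) by (intros; apply (ex_RInt_cont (V := R_CompleteNormedModule)), Hf).
assert (Hpos : forall x, 0 <= f x).
{ intros x. unfold f. rewrite pow_mult. apply pow_le, pow2_ge_0. }
set (p := t - 1 / (2 * d)).
assert (Hi : 0 < 1 / (2 * d)) by (apply Rdiv_lt_0_compat; lra).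
assert (Hp : 0 <= p).
{ unfold p. apply (Rmult_le_reg_r (2 * d)); [lra|].
  replace ((t - 1 / (2 * d)) * (2 * d)) with (2 * d * t - 1) by (field; lra). lra. }
assert (E : RInt f 0 N = RInt f 0 p + (RInt f p t + RInt f t N)).
{ rewrite <- (RInt_Chasles f 0 p N), <- (RInt_Chasles f p t N) by apply Hex. reflexivity. }
rewrite E.
assert (H1 : 0 <= RInt f 0 p) by (apply RInt_ge_0; [exact Hp|apply Hex|intros; apply Hpos]).
assert (H2 : 0 <= RInt f t N) by (apply RInt_ge_0; [exact HN|apply Hex|intros; apply Hpos]).
assert (H3 : (1 / 2) ^ (2 * j) / (2 * d) <= RInt f p t); [|lra].
replace ((1 / 2) ^ (2 * j) / (2 * d)) with (RInt (fun _ => (1 / 2) ^ (2 * j)) p t).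
- apply RInt_le; [unfold p; lra|apply ex_RInt_const|apply Hex|].
  intros x Hx. unfold f. apply pow_incr.
  assert (Hx' : 0 <= d * (t - x) <= 1 / 2).
  { unfold p in Hx. split; [nra|]. apply Rle_trans with (d * (1 / (2 * d))); [|right; field; lra].
    apply Rmult_le_compat_l; lra. }
  pose proof (sinc_near0 (d * (t - x))) as Hs. rewrite (Rabs_pos_eq (d * _)) in Hs by lra.
  apply Rabs_le_between in Hs. lra.
- rewrite RInt_const. change (scal (t - p) ((1 / 2) ^ (2 * j))) with ((t - p) * (1 / 2) ^ (2 * j)).
  unfold p. change ((t - (t - 1 / (2 * d))) * (1 / 2) ^ (2 * j) = (1 / 2) ^ (2 * j) / (2 * d)). field. lra.
Qed.

Lemma is_RInt_scal_const {V : CompleteNormedModule R_AbsRing} (f : R -> R) (u : V) a b :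
  (forall x, continuous f x) ->
  is_RInt (fun x => scal (f x) u) a b (scal (RInt f a b) u).
Proof.
intros Hf.
(* integrate the derivative of [scal (RInt f a x) u] *)
replace (scal (RInt f a b) u) with (minus (scal (RInt f a b) u) (scal (RInt f a a) u)).
- apply (is_RInt_derive (V := V) (fun x => scal (RInt f a x) u)).
  + intros x _. apply (is_derive_scal_l (K := R_AbsRing) (V := V)).
    apply (is_derive_RInt (V := R_NormedModule) f (fun x => RInt f a x) a x); [|apply Hf].
    exists (mkposreal 1 Rlt_0_1). intros y _. apply (RInt_correct (V := R_CompleteNormedModule)).
    apply (ex_RInt_cont (V := R_CompleteNormedModule)), Hf.
  + intros x _. apply (continuous_scal_l (K := R_AbsRing) (V := V)). apply Hf.
- rewrite RInt_point. change (minus (scal (RInt f a b) u) (scal (0 : R) u) = scal (RInt f a b) u). module_eq.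
Qed.

Section Smoothing.
Variables (V : CompleteNormedModule R_AbsRing) (J : V -> V).
Hypothesis HJ : complex_structure J.

(** Convolution with the kernel [sinc (d v) ^ n], whose mass is of order [1 / d],
    reproduces [u] up to an error of order [1 / d ^ 2], if [g x] tends to [u] linearly as
    [x] tends to [t]. The bound may grow like [|t - x| ^ (r + 1)] away from [t]. *)
Lemma smoothing_error (g : R -> V) (u : V) (b b1 b2 d t N : R) (r n : nat) :
  0 < d -> 0 <= N -> 0 <= b -> 0 <= b1 -> 0 <= b2 -> (r + 3 <= n)%nat -> (forall x, continuous g x) ->
  (forall x, 0 <= x <= N -> norm (minus u (g x)) <=
       b * (Rabs (t - x) * (b1 + b2 * (INR n * d * Rabs (t - x)) ^ r))) ->
  norm (minus (scal (RInt (fun x => sinc (d * (t - x)) ^ n) 0 N) u)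
     (RInt (fun x => scal (sinc (d * (t - x)) ^ n) (g x)) 0 N))
  <= b * (2 * (b1 + b2 * INR n ^ r)) * PI / d ^ 2.
Proof.
intros Hd HN Hb Hb1 Hb2 Hn Hg Hle.
assert (Hk : forall x, continuous (fun x => sinc (d * (t - x)) ^ n) x) by (intros; apply continuous_sinc_pow).
set (B := b * (2 * (b1 + b2 * INR n ^ r)) / d).
assert (Hnr : 0 <= INR n ^ r) by (apply pow_le, pos_INR).
assert (HB : 0 <= B).
{ unfold B. apply Rmult_le_pos; [|apply Rlt_le, Rinv_0_lt_compat, Hd].
  apply Rmult_le_pos; [exact Hb|]. pose proof (Rmult_le_pos _ _ Hb2 Hnr). lra. }
apply Rle_trans with ((B * (- atan (d * (t - N)) / d)) - (B * (- atan (d * (t - 0)) / d))).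
- apply (norm_RInt_le (fun x => scal (sinc (d * (t - x)) ^ n) (minus u (g x)))
     (fun x => B / (1 + (d * (t - x)) ^ 2)) 0 N); [exact HN| | |].
  + intros x Hx. eapply Rle_trans; [apply norm_scal_le|].
    rewrite <- RPow_abs.
    eapply Rle_trans; [apply Rmult_le_compat_l; [apply pow_le, Rabs_pos|apply Hle, Hx]|].
    pose proof (sinc_kernel_bound n r b1 (b2 * INR n ^ r) (d * (t - x)) Hb1 (Rmult_le_pos _ _ Hb2 Hnr) Hn) as H.
    rewrite (Rabs_mult d), (Rabs_pos_eq d) in H by lra.
    apply (Rmult_le_compat_l (b / d)) in H; [|apply Rmult_le_pos; [exact Hb|apply Rlt_le, Rinv_0_lt_compat, Hd]].
    replace (INR n * d * Rabs (t - x)) with (INR n * (d * Rabs (t - x))) by ring.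
    rewrite Rpow_mult_distr. pose proof (pow2_ge_0 (d * (t - x))).
    eapply Rle_trans; [|eapply Rle_trans; [exact H|]]; right; [field; lra|unfold B; field; split; lra].
  + eapply is_RInt_ext; [|apply (is_RInt_minus (V := V)); [apply is_RInt_scal_const, Hk|apply (RInt_correct (V := V))]].
    * intros x _. simpl. module_eq.
    * apply ex_RInt_cont. intros x. apply (continuous_scal (fun x => sinc (d * (t - x)) ^ n) g); auto.
  + apply (is_RInt_derive (V := R_CompleteNormedModule) (fun x => B * (- atan (d * (t - x)) / d))).
    * intros x _. evar_last.
      -- apply (is_derive_scal (fun x => - atan (d * (t - x)) / d)).
         apply is_derive_Reals. 
         apply (derivable_pt_lim_scal_right (fun x => - atan (d * (t - x)))).
         apply (derivable_pt_lim_opp (fun x => atan (d * (t - x)))).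
         apply (derivable_pt_lim_comp (fun x => d * (t - x)) atan).
         ++ apply is_derive_Reals. auto_derive; [trivial|reflexivity].
         ++ apply derivable_pt_lim_atan.
      -- pose proof (pow2_ge_0 (d * (t - x))). field. lra.
    * intros x _. apply continuity_pt_filterlim. apply derivable_continuous_pt.
      apply ex_derive_Reals_0. auto_derive. pose proof (pow2_ge_0 (d * (t - x))). simpl in *. lra.
- pose proof (atan_bound (d * (t - N))). pose proof (atan_bound (d * (t - 0))).
  replace (b * (2 * (b1 + b2 * INR n ^ r)) * PI / d ^ 2) with (B * (PI / d)) by (unfold B; field; lra).
  replace (B * (- atan (d * (t - N)) / d) - B * (- atan (d * (t - 0)) / d))
    with (B * ((atan (d * (t - 0)) - atan (d * (t - N))) / d)) by (field; lra).
  apply Rmult_le_compat_l; [exact HB|]. apply Rmult_le_compat_r; [apply Rlt_le, Rinv_0_lt_compat, Hd|]. lra.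
Qed.

(** The [n] factors [sinc (d v)] shift frequencies by at most [n d = R0] altogether, so
    that only the Fourier transform on [[- R0, R0]] matters. The first average turns
    its decay [1 / sqrt (s ^ 2 + 1)] into the logarithm [arcsinh R0] and a gain [1 / d];
    the other averages keep that bound. *)
Lemma iterated_average (g : R -> V) (a b d t R0 W : R) (n : nat) :
  a <= b -> 0 < d -> (1 <= n)%nat -> R0 = INR n * d -> 0 <= W -> (forall x, continuous g x) ->
  (forall s, Rabs s <= R0 ->
     norm (RInt (fun x => rot J (s * (t - x)) (g x)) a b) <= W / sqrt (s ^ 2 + 1)) ->
  norm (RInt (fun x => scal (sinc (d * (t - x)) ^ n) (g x)) a b) <= W * arcsinh R0 / d.
Proof.
intros Hab Hd Hn HR HW Hg H0.
set (h := fun j x => scal (sinc (d * (t - x)) ^ j) (g x)).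
assert (Hh : forall j x, continuous (h j) x).
{ intros j x. apply (continuous_scal (fun x => sinc (d * (t - x)) ^ j) g); [apply continuous_sinc_pow|apply Hg]. }
assert (Hstep : forall j s, RInt (fun x => rot J (s * (t - x)) (h (S j) x)) a b
   = RInt (fun x => scal (sinc (d * (t - x))) (rot J (s * (t - x)) (h j x))) a b).
{ intros j s. apply RInt_ext. intros x _. unfold h. rewrite !rot_scal by exact HJ. simpl pow. module_eq. }
assert (Hind : forall j, (S j <= n)%nat -> forall s, Rabs s <= R0 - INR (S j) * d ->
   norm (RInt (fun x => rot J (s * (t - x)) (h (S j) x)) a b) <= W * arcsinh R0 / d).
{ induction j as [|j IH]; intros Hj s Hs; rewrite Hstep.
  - change (INR 1) with 1 in Hs. apply Rabs_le_between in Hs.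
    eapply Rle_trans.
    + apply (sinc_average V J HJ (h 0%nat) a b t d s
        (fun s => W * arcsinh s) (fun s => W * / sqrt (s ^ 2 + 1)) Hab Hd (Hh 0%nat)).
      * intros s'. apply is_derive_scal. apply is_derive_Reals. apply derivable_pt_lim_arcsinh.
      * intros s'. apply continuity_pt_filterlim. apply derivable_continuous_pt.
        apply ex_derive_Reals_0. auto_derive. pose proof (pow2_ge_0 s'). simpl in *.
        repeat split; [lra|]. apply Rgt_not_eq. apply sqrt_lt_R0. lra.
      * intros s' Hs'. eapply Rle_trans; [|apply (H0 s'); apply Rabs_le; lra]. right.
        apply f_equal. apply RInt_ext. intros x _. unfold h. simpl pow. f_equal. module_eq.
    + assert (arcsinh (s + d) <= arcsinh R0) by (apply arcsinh_le; lra).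
      assert (- arcsinh R0 <= arcsinh (s - d)) by (rewrite <- arcsinh_odd; apply arcsinh_le; lra).
      apply (Rmult_le_reg_r (2 * d)); [lra|].
      replace ((W * arcsinh (s + d) - W * arcsinh (s - d)) / (2 * d) * (2 * d))
        with (W * (arcsinh (s + d) - arcsinh (s - d))) by (field; lra).
      replace (W * arcsinh R0 / d * (2 * d)) with (W * (arcsinh R0 + arcsinh R0)) by (field; lra).
      apply Rmult_le_compat_l; lra.
  - rewrite S_INR in Hs. apply Rabs_le_between in Hs.
    set (Y := W * arcsinh R0 / d) in *.
    replace Y with ((Y * (s + d) - Y * (s - d)) / (2 * d)) by (field; lra).
    apply (sinc_average V J HJ (h (S j)) a b t d s (fun s => Y * s) (fun s => Y) Hab Hd (Hh (S j))).
    + intros s'. auto_derive; [trivial|ring].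
    + intros s'. apply continuous_const.
    + intros s' Hs'. apply IH; [lia|]. apply Rabs_le. lra. }
destruct n as [|n]; [lia|].
eapply Rle_trans; [|apply (Hind n (le_n _) 0)].
- right. apply f_equal. apply RInt_ext. intros x _. rewrite Rmult_0_l, rot_0. reflexivity.
- rewrite Rabs_R0, HR. lra.
Qed.

End Smoothing.

(** * Decay of an orbit from bounds on the resolvent *)

Section Core.
Variables (V : CompleteNormedModule R_AbsRing) (J : V -> V).
Hypothesis HJ : complex_structure J.
Variables (U : R -> V -> V) (K : R).
Hypothesis HK : 0 <= K.
Hypothesis Ucont : forall z x, continuous (fun x => U x z) x.
Hypothesis Unorm : forall z x, 0 <= x -> norm (U x z) <= K * norm z.

(** [Q = (i s - A)^-1] in the form [A Q = i s Q - 1], read off the derivative of orbits,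
    so that the generator itself does not occur. *)
Definition is_resolvent_at (s : R) (Q : V -> V) : Prop :=
  forall z x, 0 <= x ->
    is_derive (fun x => U x (Q z)) x (minus (scal s (J (U x (Q z)))) (U x z)).

(** The Fourier transform of the weighted orbit, by [norm_weight_integral_le]: the phase
    turns the semigroup generated by [A] into the one generated by [A - i s]. *)
Lemma transform_bound s Q m k L t z :
  is_resolvent_at s Q -> (forall z, norm (Q z) <= m * norm z) -> 0 < m -> 0 < t -> 1 < L ->
  (1 <= k)%nat -> INR k * m <= t ->
  norm (RInt (fun x => rot J (s * (t - x)) (scal (weight k (L * t) t x) (U x z))) 0 (L * t))
    <= 2 * K * (exp 1 * INR k * (exp (- INR k) * ((L + 2) / (L - 1)) ^ k)) * norm (Q z).
Proof.
intros HQ HQn Hm Ht HL Hk Hkm.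
set (N := L * t). assert (HN : 0 < N) by (unfold N; nra).
set (E := fun x v => rot J (s * (t - x)) (U x v)).
assert (HrotN : forall a v, norm (rot J a v) <= norm v) by (intros; apply (cs_isometry J HJ)).
assert (HEn : forall v x, 0 <= x -> norm (E x v) <= K * norm v).
{ intros v x Hx. eapply Rle_trans; [apply HrotN|]. apply Unorm, Hx. }
assert (HEc : forall v x, continuous (fun x => E x v) x).
{ intros v x. apply (continuous_rot V J HJ (fun x => s * (t - x))); [apply continuous_affine|apply Ucont]. }
assert (HEd : forall v x, 0 <= x <= N -> is_derive (fun x => E x (Q v)) x (opp (E x v))).
{ intros v x Hx. unfold E. evar_last.
  - apply (is_derive_rot V J HJ (fun x => s * (t - x)) (fun x => U x (Q v)) x (- s)).
    + auto_derive; [trivial|ring].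
    + apply HQ. lra.
  - replace (opp (rot J (s * (t - x)) (U x v))) with (scal (-1) (rot J (s * (t - x)) (U x v))) by module_eq.
    rewrite <- rot_scal by exact HJ. f_equal. module_eq. }
set (c0 := / (t * (N - t)) ^ k).
assert (Hden : 0 < (t * (N - t)) ^ k) by (apply pow_lt, Rmult_lt_0_compat; unfold N; nra).
assert (Hc0 : 0 < c0) by (apply Rinv_0_lt_compat, Hden).
replace (RInt (fun x => rot J (s * (t - x)) (scal (weight k N t x) (U x z))) 0 N)
  with (scal c0 (RInt (fun x => scal (x ^ k * (N - x) ^ k) (E x z)) 0 N)).
- eapply Rle_trans; [apply norm_scal_le|]. rewrite Rabs_pos_eq by lra.
  apply Rle_trans with (c0 * (2 * K * end_bound m N k k * norm (Q z))).
  + apply Rmult_le_compat_l; [lra|].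
    apply (norm_weight_integral_le V E Q K m N HK); try lra; auto.
    * intros v. apply HEn. lra.
    * intros v. apply HEn. lra.
  + replace (c0 * (2 * K * end_bound m N k k * norm (Q z)))
      with (2 * K * (end_bound m N k k / (t * (N - t)) ^ k) * norm (Q z)) by (unfold c0; field; lra).
    apply Rmult_le_compat_r; [apply norm_ge_0|]. apply Rmult_le_compat_l; [lra|].
    apply end_bound_ratio; assumption.
- symmetry. apply (is_RInt_unique (V := V)).
  eapply is_RInt_ext; [|apply (is_RInt_scal (V := V)); apply (RInt_correct (V := V))].
  + intros x _. simpl. rewrite rot_scal by exact HJ. unfold weight, E. fold c0.
    module_eq_with ltac:(unfold c0, Rdiv; ring).
  + apply ex_RInt_cont. intros x. apply (continuous_scal (fun x => x ^ k * (N - x) ^ k) (fun x => E x z)); [|apply HEc].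
    apply continuity_pt_filterlim. apply derivable_continuous_pt.
    eexists. apply is_derive_Reals. apply is_derive_weight.
Qed.

(** [m] stands for [M R0]. The orbit at time [t] is compared with the convolution of
    the weighted orbit with the kernel [sinc (d v) ^ n]: the difference is bounded by
    [smoothing_error], and the convolution by [iterated_average] applied to
    [transform_bound]. *)
Lemma orbit_decay M0 D c : 0 < M0 -> 0 <= D -> 0 < c < 1 -> exists C t0, 0 <= C /\
  forall m R0 t z (Q : R -> V -> V),
  M0 <= m -> 1 <= R0 -> 1 <= ln (R0 * m) -> c * t = m * ln (R0 * m) -> t0 <= t ->
  (forall s, Rabs s <= R0 -> is_resolvent_at s (Q s)) ->
  (forall s, Rabs s <= R0 -> forall v, norm (Q s v) <= m * norm v) ->
  (forall s, Rabs s <= R0 -> norm (Q s z) <= D * m / sqrt (s ^ 2 + 1)) ->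
  (forall x, 0 <= x -> norm (U x z) <= D) ->
  (forall x x', 0 <= x -> 0 <= x' -> norm (minus (U x z) (U x' z)) <= D * Rabs (x - x')) ->
  norm (U t z) <= C / R0.
Proof.
intros HM0 HD Hc.
destruct (ratio_limit c (proj2 Hc)) as (L & HL & Hq).
(* [r] is such that (1 + 2 L) ^ k <= (R0 m) ^ r as soon as k <= ln (R0 m) / c. *)
destruct (nfloor_ex (ln (1 + 2 * L) / c)) as [r0 Hr0].
{ apply Rmult_le_pos; [|apply Rlt_le, Rinv_0_lt_compat; lra].
  rewrite <- ln_1. apply ln_le; lra. }
set (r := S r0).
assert (Hr : ln (1 + 2 * L) / c <= INR r) by (unfold r; rewrite S_INR; lra).
(* [n] is even to make the kernel nonnegative, and at least r + 3 to absorb the power r. *)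
set (n := (2 * (r + 2))%nat).
assert (Hn0 : 0 < INR n) by (apply lt_0_INR; unfold n; lia).
set (b1 := 1 + 2 / M0 * exp 2). set (b2 := 2 / M0).
assert (H2M : 0 < 2 / M0) by (apply Rdiv_lt_0_compat; lra).
assert (Hb1 : 0 <= b1) by (unfold b1; pose proof (exp_pos 2); nra).
assert (Hb2 : 0 <= b2) by (unfold b2; lra).
set (C1 := 2 * K * D * (exp 1 * (exp 1 / c) * (1 + Rabs (ln (3 / M0))) * (4 / ((1 - c) / (2 * c)) ^ 2))).
set (C2 := D * (2 * (b1 + b2 * INR n ^ r)) * PI).
assert (HC1 : 0 <= C1).
{ unfold C1. pose proof (exp_pos 1). pose proof (Rabs_pos (ln (3 / M0))).
  assert (0 < exp 1 / c) by (apply Rdiv_lt_0_compat; lra).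
  assert (0 < (1 - c) / (2 * c)) by (apply Rdiv_lt_0_compat; lra).
  repeat apply Rmult_le_pos; try lra; apply Rlt_le, Rinv_0_lt_compat; [lra|apply pow_lt; assumption]. }
assert (HC2 : 0 <= C2).
{ unfold C2. pose proof PI_RGT_0. pose proof (pow_le (INR n) r (Rlt_le _ _ Hn0)).
  pose proof (Rmult_le_pos _ _ Hb2 H0).
  apply Rmult_le_pos; [apply Rmult_le_pos|]; lra. }
exists (2 ^ n * 2 * (C1 + C2 * INR n)), (Rmax 1 (INR n)).
split.
{ apply Rmult_le_pos; [apply Rmult_le_pos; [apply pow_le|]; lra|].
  pose proof (Rmult_le_pos _ _ HC2 (Rlt_le _ _ Hn0)). lra. }
intros m R0 t z Q Hm HR Hlam Hct Ht0 HQ HQn HQz HUz HUlip.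
assert (Ht1 : 1 <= t) by (eapply Rle_trans; [apply Rmax_l|exact Ht0]).
assert (Htn : INR n <= t) by (eapply Rle_trans; [apply Rmax_r|exact Ht0]).
set (lam := ln (R0 * m)) in *.
assert (Htm : t / m = lam / c).
{ apply (Rmult_eq_reg_l (m * c)); [|apply Rgt_not_eq, Rmult_lt_0_compat; lra].
  replace (m * c * (t / m)) with (c * t) by (field; lra). rewrite Hct. field. lra. }
(* [k = floor (t / m)] nearly minimises k! (m / t) ^ k. *)
destruct (nfloor_ex (t / m)) as [k [Hk1 Hk2]].
{ apply Rlt_le, Rdiv_lt_0_compat; lra. }
assert (Hk : (1 <= k)%nat).
{ destruct k as [|k]; [|lia]. exfalso. simpl in Hk2. rewrite Htm in Hk2.
  assert (1 <= lam / c); [|lra].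
  apply (Rmult_le_reg_r c); [lra|]. unfold Rdiv. rewrite Rmult_assoc, Rinv_l; lra. }
assert (Hkm : INR k * m <= t).
{ apply (Rmult_le_compat_r m) in Hk1; [|lra]. replace (t / m * m) with t in Hk1 by (field; lra). exact Hk1. }
assert (HLk : (1 + 2 * L) ^ k <= (R0 * m) ^ r).
{ assert (HRm : 0 < R0 * m) by nra.
  rewrite <- (exp_ln (1 + 2 * L)), <- (exp_ln (R0 * m)) by lra. rewrite <- !exp_INR_mult.
  fold lam. assert (H : INR k * ln (1 + 2 * L) <= INR r * lam).
  { apply Rle_trans with (lam / c * ln (1 + 2 * L)).
    - apply Rmult_le_compat_r; [rewrite <- ln_1; apply ln_le; lra|lra].
    - replace (lam / c * ln (1 + 2 * L)) with (ln (1 + 2 * L) / c * lam) by (field; lra).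
      apply Rmult_le_compat_r; lra. }
  destruct H as [H|H]; [left; apply exp_increasing, H|right; rewrite H; reflexivity]. }
set (N := L * t). assert (HtN : t < N) by (unfold N; nra).
set (d := R0 / INR n).
assert (Hd : 0 < d) by (apply Rdiv_lt_0_compat; lra).
assert (HRd : R0 = INR n * d) by (unfold d; field; lra).
set (w := fun x => scal (weight k N t x) (U x z)).
assert (Hw : forall x, continuous w x).
{ intros x. apply (continuous_scal (weight k N t) (fun x => U x z)); [|apply Ucont].
  apply (continuous_scal_l (K := R_AbsRing) (V := R_NormedModule) (fun x => x ^ k * (N - x) ^ k)).
  apply continuity_pt_filterlim. apply derivable_continuous_pt.
  eexists. apply is_derive_Reals. apply is_derive_weight. }
set (Z := exp 1 * INR k * (exp (- INR k) * ((L + 2) / (L - 1)) ^ k)).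
assert (HZ : 0 <= Z).
{ unfold Z. pose proof (exp_pos 1). pose proof (exp_pos (- INR k)).
  repeat apply Rmult_le_pos; try lra; [apply pos_INR|]. apply pow_le, Rlt_le, Rdiv_lt_0_compat; lra. }
assert (Hmain : norm (RInt (fun x => scal (sinc (d * (t - x)) ^ n) (w x)) 0 N) <= C1 / R0 / d).
{ eapply Rle_trans.
  - apply (iterated_average V J HJ w 0 N d t R0 (2 * K * D * (Z * m)) n); auto; [lra|unfold n; lia| |].
    + apply Rmult_le_pos; apply Rmult_le_pos; lra.
    + intros s Hs. unfold w, N. eapply Rle_trans.
      * apply (transform_bound s (Q s) m k L t z (HQ s Hs) (HQn s Hs)); try assumption; lra.
      * fold Z. apply Rle_trans with (2 * K * Z * (D * m / sqrt (s ^ 2 + 1))); [|right; unfold Rdiv; ring].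
        apply Rmult_le_compat_l; [apply Rmult_le_pos; lra|apply HQz, Hs].
  - apply Rmult_le_compat_r; [apply Rlt_le, Rinv_0_lt_compat, Hd|].
    replace (2 * K * D * (Z * m) * arcsinh R0) with (2 * K * D * (m * Z * arcsinh R0)) by ring.
    unfold C1, Rdiv at 1. rewrite (Rmult_assoc (2 * K * D)).
    apply Rmult_le_compat_l; [apply Rmult_le_pos; lra|].
    apply decay_numeric; try assumption; [lra|]. fold lam. rewrite <- Htm. lra. }
assert (Herr : norm (minus (scal (RInt (fun x => sinc (d * (t - x)) ^ n) 0 N) (U t z))
     (RInt (fun x => scal (sinc (d * (t - x)) ^ n) (w x)) 0 N)) <= C2 / d ^ 2).
{ unfold C2. apply smoothing_error; try assumption; [unfold N; nra|unfold n; lia|].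
  intros x Hx. rewrite <- HRd.
  replace (minus (U t z) (w x))
    with (minus (minus (U t z) (U x z)) (scal (weight k N t x - 1) (U x z)))
    by (unfold w; module_eq).
  eapply Rle_trans; [apply norm_minus_le|].
  assert (H1 : norm (minus (U t z) (U x z)) <= D * Rabs (t - x)) by (apply HUlip; lra).
  assert (H2 : norm (scal (weight k N t x - 1) (U x z)) <=
    D * Rabs (t - x) * (2 / M0 * exp 2 + b2 * (R0 * Rabs (t - x)) ^ r)).
  { eapply Rle_trans; [apply norm_scal_le|].
    pose proof (weight_deviation k t L x m R0 r ltac:(lra) HL Hx ltac:(lra) Hkm ltac:(lra) HLk) as H.
    fold N in H. pose proof (Rabs_pos (t - x)) as Hv.
    assert (HRv : 0 <= (R0 * Rabs (t - x)) ^ r) by (apply pow_le; nra).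
    pose proof (exp_pos 2).
    assert (H2m : 2 / m <= 2 / M0).
    { apply Rmult_le_compat_l; [lra|]. apply Rinv_le_contravar; lra. }
    apply Rle_trans with (2 / M0 * Rabs (t - x) * (exp 2 + (R0 * Rabs (t - x)) ^ r) * D); [|unfold b2; right; ring].
    apply Rmult_le_compat; [apply Rabs_pos|apply norm_ge_0| |apply HUz; lra].
    eapply Rle_trans; [exact H|]. apply Rmult_le_compat_r; [lra|]. apply Rmult_le_compat_r; lra. }
  unfold b1. lra. }
set (kap := RInt (fun x => sinc (d * (t - x)) ^ n) 0 N) in *.
assert (Hkap : (1 / 2) ^ n / (2 * d) <= kap).
{ apply kernel_mass; [exact Hd| |lra|exists (r + 2)%nat; reflexivity].
  unfold d. apply (Rmult_le_reg_r (INR n)); [exact Hn0|].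
  replace (2 * (R0 / INR n) * t * INR n) with (2 * R0 * t) by (field; lra). nra. }
assert (Hkp : 0 < (1 / 2) ^ n / (2 * d)).
{ apply Rdiv_lt_0_compat; [apply pow_lt; lra|lra]. }
set (I := RInt (fun x => scal (sinc (d * (t - x)) ^ n) (w x)) 0 N) in *.
assert (Hnorm : kap * norm (U t z) <= C1 / R0 / d + C2 / d ^ 2).
{ replace (U t z) with (scal (/ kap) (plus (minus (scal kap (U t z)) I) I)) by (module_eq_with ltac:(try (field; lra))).
  apply Rle_trans with (kap * (/ kap * norm (plus (minus (scal kap (U t z)) I) I))).
  - apply Rmult_le_compat_l; [lra|]. eapply Rle_trans; [apply norm_scal_le|].
    rewrite Rabs_pos_eq; [lra|]. apply Rlt_le, Rinv_0_lt_compat. lra.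
  - rewrite <- Rmult_assoc, Rinv_r, Rmult_1_l by lra.
    eapply Rle_trans; [apply norm_plus_le|]. lra. }
pose proof (norm_ge_0 (U t z)) as Hu.
assert (H : (1 / 2) ^ n / (2 * d) * norm (U t z) <= C1 / R0 / d + C2 / d ^ 2) by nra.
apply (Rmult_le_reg_l ((1 / 2) ^ n / (2 * d))); [exact Hkp|].
eapply Rle_trans; [exact H|]. right.
replace ((1 / 2) ^ n) with (/ 2 ^ n) by (rewrite <- pow_inv; f_equal; field).
assert (2 ^ n <> 0) by (apply pow_nonzero; lra).
rewrite HRd at 1 2. field. repeat split; lra.
Qed.
End Core.

(** * Orbits of bounded semigroups *)

Section Orbit.
Variables (V : CompleteNormedModule R_AbsRing) (T : R -> V -> V) (K : R).
Hypothesis HK : 0 <= K.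
Hypothesis Tplus : forall t x y, 0 <= t -> T t (plus x y) = plus (T t x) (T t y).
Hypothesis Tscal : forall t (k : R) x, 0 <= t -> T t (scal k x) = scal k (T t x).
Hypothesis Tnorm : forall t x, 0 <= t -> norm (T t x) <= K * norm x.
Hypothesis T0 : forall x, T 0 x = x.
Hypothesis Tsum : forall s t x, 0 <= s -> 0 <= t -> T (s + t) x = T s (T t x).
Hypothesis Tcont : forall x (eps : posreal), exists d : posreal, forall h, 0 <= h < d ->
  norm (minus (T h x) x) <= eps.

(** Odd reflection through [(0, x)] extends every orbit to the real line, continuously,
    and differentiably at [0] if [x] is in the domain of the generator. Integrals and
    derivatives on [[0, N]] thus need no separate treatment of the end point [0]. *)
Definition reflected_orbit (t : R) (x : V) : V :=
  if Rle_dec 0 t then T t x else minus (scal 2 x) (T (- t) x).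

Lemma reflected_orbit_pos t x : 0 <= t -> reflected_orbit t x = T t x.
Proof. intros H. unfold reflected_orbit. destruct (Rle_dec 0 t); [reflexivity|contradiction]. Qed.

Lemma semigroup_minus t x y : 0 <= t -> T t (minus x y) = minus (T t x) (T t y).
Proof.
intros Ht. replace (minus x y) with (plus x (scal (-1) y)) by module_eq.
rewrite Tplus, Tscal by exact Ht. module_eq.
Qed.

Lemma semigroup_increment s t x : 0 <= s <= t -> norm (minus (T t x) (T s x)) <= K * norm (minus (T (t - s) x) x).
Proof.
intros H. replace t with (s + (t - s)) at 1 by ring.
rewrite Tsum by lra. rewrite <- semigroup_minus by lra. apply Tnorm. lra.
Qed.

Lemma norm_minus_sym (x y : V) : norm (minus x y) = norm (minus y x).
Proof. rewrite <- norm_opp_eq. f_equal. module_eq. Qed.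

Lemma continuous_reflected_orbit x t : continuous (fun t => reflected_orbit t x) t.
Proof.
apply (filterlim_locally_ball_norm (K := R_AbsRing) (U := V)). intros eps.
assert (He : 0 < eps / (K + 3)) by (apply Rdiv_lt_0_compat; [apply eps|lra]).
destruct (Tcont x (mkposreal _ He)) as [d Hd]. simpl in Hd.
exists d. intros t' Ht'. change (Rabs (t' - t) < d) in Ht'.
unfold ball_norm. change (norm (minus (reflected_orbit t' x) (reflected_orbit t x)) < eps).
set (e := eps / (K + 3)) in *.
assert (Hee : (K + 2) * e < eps).
{ replace (pos eps) with ((K + 3) * e) by (unfold e; field; lra). apply Rmult_lt_compat_r; lra. }
eapply Rle_lt_trans; [|exact Hee].
assert (Hmain : forall a b, 0 <= a -> 0 <= b -> Rabs (a - b) < d -> norm (minus (T a x) (T b x)) <= K * e).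
{ intros a b Ha Hb Hab. apply Rabs_def2 in Hab. destruct (Rle_dec b a) as [h|h].
  - eapply Rle_trans; [apply semigroup_increment; lra|]. apply Rmult_le_compat_l; [exact HK|]. apply Hd. lra.
  - rewrite norm_minus_sym. eapply Rle_trans; [apply semigroup_increment; lra|].
    apply Rmult_le_compat_l; [exact HK|]. apply Hd. lra. }
assert (Hmix : forall a b, 0 <= a < d -> 0 <= b < d -> norm (minus (T a x) (minus (scal 2 x) (T b x))) <= 2 * e).
{ intros a b Ha Hb.
  replace (minus (T a x) (minus (scal 2 x) (T b x))) with (plus (minus (T a x) x) (minus (T b x) x)) by module_eq.
  eapply Rle_trans; [apply norm_plus_le|]. pose proof (Hd a Ha). pose proof (Hd b Hb). lra. }
assert (HKe : 0 <= K * e) by (apply Rmult_le_pos; lra).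
apply Rabs_def2 in Ht'.
unfold reflected_orbit. destruct (Rle_dec 0 t') as [h|h]; destruct (Rle_dec 0 t) as [k|k].
- eapply Rle_trans; [apply Hmain; try assumption; apply Rabs_def1; lra|]. lra.
- eapply Rle_trans; [apply Hmix; lra|]. lra.
- rewrite norm_minus_sym. eapply Rle_trans; [apply Hmix; lra|]. lra.
- apply Rle_trans with (norm (minus (T (- t) x) (T (- t') x))); [right; apply f_equal; module_eq|].
  eapply Rle_trans; [apply Hmain; try lra; apply Rabs_def1; lra|]. lra.
Qed.

(** A left difference quotient at [t > 0] is [T (t - k)] applied to the difference
    quotient at [0], whence the limit, because [T] is bounded. *)
Lemma is_derive_reflected_orbit x y t : 0 <= t ->
  (forall eps : posreal, exists d : posreal, forall h, 0 < h < d ->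
     norm (minus (minus (T h x) x) (scal h y)) <= eps * h) ->
  is_derive (fun t => reflected_orbit t x) t (T t y).
Proof.
intros Ht Hg. apply is_derive_small. intros eps.
assert (He : 0 < eps / (2 * K + 1)) by (apply Rdiv_lt_0_compat; [apply eps|lra]).
destruct (Hg (mkposreal _ He)) as [d1 Hd1]. simpl in Hd1.
destruct (Tcont y (mkposreal _ He)) as [d2 Hd2]. simpl in Hd2.
set (e := eps / (2 * K + 1)) in *.
assert (Hee : (2 * K + 1) * e = eps) by (unfold e; field; lra).
set (d := Rmin (Rmin d1 d2) (if Rlt_dec 0 t then t else 1)).
assert (Hd : 0 < d).
{ unfold d. repeat apply Rmin_glb_lt; try apply cond_pos. destruct (Rlt_dec 0 t); lra. }
exists (mkposreal _ Hd). intros h Hh. simpl in Hh.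
change (norm (minus (minus (reflected_orbit (t + h) x) (reflected_orbit t x)) (scal h (T t y))) <= eps * Rabs h).
assert (Hhd : Rabs h < d1 /\ Rabs h < d2 /\ (0 < t -> Rabs h < t)).
{ unfold d in Hh. pose proof (Rmin_l (Rmin d1 d2) (if Rlt_dec 0 t then t else 1)).
  pose proof (Rmin_r (Rmin d1 d2) (if Rlt_dec 0 t then t else 1)).
  pose proof (Rmin_l d1 d2). pose proof (Rmin_r d1 d2).
  repeat split; try lra. intros k. destruct (Rlt_dec 0 t); lra. }
clearbody d. destruct Hhd as (Ha & Hb & Hc). rewrite <- Hee.
rewrite (reflected_orbit_pos t x Ht).
assert (He0 : 0 <= K * e) by (apply Rmult_le_pos; lra).
destruct (Rtotal_order h 0) as [Hn|[H0|Hp]].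
- rewrite (Rabs_left h Hn) in *. set (k := - h) in *. assert (Hk : 0 < k) by (unfold k; lra).
  assert (h = - k) by (unfold k; ring). clearbody k. subst h.
  destruct (Req_dec t 0) as [->|Ht0].
  + unfold reflected_orbit. destruct (Rle_dec 0 (0 + - k)); [lra|].
    replace (- (0 + - k)) with k by ring. rewrite !T0.
    apply Rle_trans with (norm (opp (minus (minus (T k x) x) (scal k y)))); [right; apply f_equal; module_eq|].
    rewrite norm_opp_eq. eapply Rle_trans; [apply Hd1; lra|]. apply Rmult_le_compat_r; lra.
  + assert (Hkt : k < t) by (apply Hc; lra).
    rewrite reflected_orbit_pos by lra.
    replace (T t x) with (T (t + - k) (T k x)) by (rewrite <- Tsum by lra; f_equal; ring).
    replace (T t y) with (T (t + - k) (T k y)) by (rewrite <- Tsum by lra; f_equal; ring).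
    apply Rle_trans with (norm (T (t + - k) (minus (scal k (minus (T k y) y)) (minus (minus (T k x) x) (scal k y))))).
    { right. apply f_equal. rewrite ?semigroup_minus, ?Tscal, ?semigroup_minus, ?Tscal by lra. module_eq. }
    apply Rle_trans with (K * (k * e + e * k)).
    * eapply Rle_trans; [apply Tnorm; lra|]. apply Rmult_le_compat_l; [exact HK|].
      eapply Rle_trans; [apply norm_minus_le|]. apply Rplus_le_compat; [|apply Hd1; lra].
      eapply Rle_trans; [apply norm_scal_le|]. rewrite Rabs_pos_eq by lra.
      apply Rmult_le_compat_l; [lra|]. apply Hd2. lra.
    * replace (K * (k * e + e * k)) with (2 * (K * e) * k) by ring.
      apply Rmult_le_compat_r; lra.
- subst h. rewrite Rplus_0_r, Rabs_R0, Rmult_0_r.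
  apply Rle_trans with (norm (zero : V)); [right; apply f_equal|rewrite norm_zero_eq; lra].
  rewrite (reflected_orbit_pos t x Ht). module_eq.
- rewrite (Rabs_pos_eq h) in * by lra. rewrite reflected_orbit_pos by lra.
  rewrite Tsum by lra.
  apply Rle_trans with (norm (T t (minus (minus (T h x) x) (scal h y)))).
  { right. apply f_equal. rewrite ?semigroup_minus, ?Tscal, ?semigroup_minus, ?Tscal by lra. reflexivity. }
  eapply Rle_trans; [apply Tnorm, Ht|].
  apply Rle_trans with (K * (e * h)); [|nra].
  apply Rmult_le_compat_l; [exact HK|]. apply Hd1. lra.
Qed.

Lemma orbit_lipschitz z y D : norm y <= D ->
  (forall t, 0 <= t -> is_derive (fun t => reflected_orbit t z) t (T t y)) ->
  forall s t, 0 <= s -> 0 <= t ->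
  norm (minus (reflected_orbit s z) (reflected_orbit t z)) <= K * D * Rabs (s - t).
Proof.
intros Hy Hder.
assert (Hle : forall s t, 0 <= s <= t -> norm (minus (reflected_orbit t z) (reflected_orbit s z)) <= K * D * (t - s)).
{ intros s t H.
  apply Rle_trans with ((t - s) * (K * D)); [|right; ring].
  apply (norm_RInt_le_const (fun t => reflected_orbit t y) s t); [lra| |].
  - intros u Hu. rewrite reflected_orbit_pos by lra. eapply Rle_trans; [apply Tnorm; lra|].
    apply Rmult_le_compat_l; assumption.
  - apply (is_RInt_derive (V := V) (fun t => reflected_orbit t z)); rewrite Rmin_left, Rmax_right by lra.
    + intros u Hu. rewrite reflected_orbit_pos by lra. apply Hder. lra.
    + intros u Hu. apply continuous_reflected_orbit. }
intros s t Hs Ht. destruct (Rle_dec s t) as [h|h].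
- rewrite norm_minus_sym, Rabs_left1 by lra. replace (- (s - t)) with (t - s) by ring. apply Hle. lra.
- rewrite Rabs_pos_eq by lra. apply Hle. lra.
Qed.
End Orbit.

(** * Complex spaces as real spaces *)

Section Realify.
Variable X : CompleteNormedModule C_AbsRing.

(** The addition, the uniform structure and the norm of [X] are kept as they are, so
    that statements about [realify X] and about [X] are convertible. *)
Definition real_module_mixin : ModuleSpace.mixin_of R_Ring (CompleteNormedModule.AbelianGroup _ X).
Proof.
apply (ModuleSpace.Mixin R_Ring (CompleteNormedModule.AbelianGroup _ X) (fun r x => scal (RtoC r : C_AbsRing) x)).
- intros r s u. rewrite scal_assoc. f_equal. symmetry. apply RtoC_mult.
- intros u. apply (scal_one (K := C_Ring) (u : X)).
- intros r u v. apply (scal_distr_l (K := C_Ring) (RtoC r : C_Ring) (u : X) v).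
- intros r s u. 
  transitivity (scal (plus (RtoC r : C_Ring) (RtoC s : C_Ring)) (u : X)).
  + f_equal. apply RtoC_plus.
  + exact (scal_distr_r (K := C_AbsRing) (V := X) (RtoC r : C_AbsRing) (RtoC s : C_AbsRing) u).
Defined.

Definition real_module : ModuleSpace R_Ring :=
  ModuleSpace.Pack R_Ring X (ModuleSpace.Class R_Ring X _ real_module_mixin) X.

Definition real_aux_class : NormedModuleAux.class_of R_AbsRing X :=
  NormedModuleAux.Class R_AbsRing X (ModuleSpace.class R_Ring real_module)
     (UniformSpace.class (CompleteNormedModule.UniformSpace _ X)).

Definition real_norm_mixin : NormedModule.mixin_of R_AbsRing (NormedModuleAux.Pack R_AbsRing X real_aux_class X).
Proof.
apply (NormedModule.Mixin R_AbsRing (NormedModuleAux.Pack R_AbsRing X real_aux_class X)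
  (fun x => norm (x : X)) (@norm_factor C_AbsRing X)).
- intros x y. apply (norm_triangle (K := C_AbsRing) (V := X)).
- intros r x. eapply Rle_trans; [apply (norm_scal (K := C_AbsRing) (V := X) (RtoC r))|].
  right. f_equal. apply Cmod_R.
- intros x y eps. apply (norm_compat1 (K := C_AbsRing) (V := X)).
- intros x y eps. apply (norm_compat2 (K := C_AbsRing) (V := X)).
- intros x. apply (norm_eq_zero (K := C_AbsRing) (V := X)).
Defined.

Definition realify : CompleteNormedModule R_AbsRing :=
  CompleteNormedModule.Pack R_AbsRing X
    (CompleteNormedModule.Class R_AbsRing X
       (NormedModule.Class R_AbsRing X real_aux_class real_norm_mixin)
       (CompleteNormedModule.mixin _ _ (CompleteNormedModule.class _ X))) X.

Definition times_i (x : realify) : realify := scal (Ci : C_AbsRing) (x : X).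
End Realify.

Lemma times_i_complex (X : CompleteNormedModule C_AbsRing) : complex_structure (times_i X).
Proof.
split.
- split.
  + intros x y. apply (scal_distr_l (K := C_AbsRing) (V := X) (Ci : C_AbsRing) x y).
  + intros r x. 
    transitivity (scal (mult (Ci : C_AbsRing) (RtoC r : C_AbsRing)) (x : X)).
    * apply (scal_assoc (K := C_AbsRing) (V := X)).
    * transitivity (scal (mult (RtoC r : C_AbsRing) (Ci : C_AbsRing)) (x : X)).
      -- f_equal. apply Cmult_comm.
      -- symmetry. apply (scal_assoc (K := C_AbsRing) (V := X)).
  + exists 1. split; [lra|]. intros x.
    eapply Rle_trans; [apply (norm_scal (K := C_AbsRing) (V := X) (Ci : C_AbsRing) x)|].
    right. f_equal. change (Cmod Ci = 1). unfold Cmod, Ci. simpl.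
    transitivity (sqrt 1); [f_equal; ring|apply sqrt_1].
- intros x. transitivity (scal (mult (Ci : C_AbsRing) (Ci : C_AbsRing)) (x : X)).
  + apply (scal_assoc (K := C_AbsRing) (V := X)).
  + transitivity (scal (opp (one : C_AbsRing)) (x : X)).
    * f_equal. change ((Ci * Ci)%C = (- RtoC 1)%C). apply injective_projections; simpl; ring.
    * apply (scal_opp_one (K := C_AbsRing) (V := X)).
- intros a x. set (z := (cos a, sin a) : C).
  assert (E : rot (times_i X) a x = scal (z : C_AbsRing) (x : X)).
  { transitivity (plus (scal (RtoC (cos a) : C_AbsRing) (x : X))
      (scal (mult (RtoC (sin a) : C_AbsRing) (Ci : C_AbsRing)) (x : X))).
    - unfold rot. apply (f_equal (fun y : X => plus (scal (RtoC (cos a) : C_AbsRing) (x : X)) y)).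
      apply (scal_assoc (K := C_AbsRing) (V := X)).
    - transitivity (scal (plus (RtoC (cos a) : C_AbsRing) (mult (RtoC (sin a) : C_AbsRing) (Ci : C_AbsRing))) (x : X)).
      + symmetry. apply (scal_distr_r (K := C_AbsRing) (V := X)).
      + f_equal. change ((RtoC (cos a) + RtoC (sin a) * Ci)%C = z). apply injective_projections; simpl; ring. }
  rewrite E. eapply Rle_trans; [apply (norm_scal (K := C_AbsRing) (V := X) (z : C_AbsRing) x)|].
  right. change (Cmod z * norm (x : X) = norm (x : X)).
  replace (Cmod z) with 1; [ring|]. unfold Cmod, z. simpl fst. simpl snd.
  transitivity (sqrt 1); [symmetry; apply sqrt_1|]. f_equal. pose proof (sin2_cos2 a). unfold Rsqr in H. simpl. lra.
Qed.

Lemma times_i_scal {X : CompleteNormedModule C_AbsRing} (s : R) (x : X) :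
  scal ((Ci * s)%C : C_AbsRing) x = (scal s (times_i X x) : realify X).
Proof.
transitivity (scal (mult (RtoC s : C_AbsRing) (Ci : C_AbsRing)) x); [f_equal; apply Cmult_comm|].
symmetry. apply (scal_assoc (K := C_AbsRing) (V := X)).
Qed.

Lemma linear_times_i {X : CompleteNormedModule C_AbsRing} (L : X -> X) (x : X) : is_linear L -> L (times_i X x) = times_i X (L x).
Proof. intros HL. apply (linear_scal L HL). Qed.

Lemma linear_real_scal {X : CompleteNormedModule C_AbsRing} (L : X -> X) (s : R) (x : realify X) : is_linear L ->
  L (scal s x) = (scal s (L x : realify X) : realify X).
Proof. intros HL. apply (linear_scal L HL). Qed.

Lemma linear_real_plus {X : CompleteNormedModule C_AbsRing} (L : X -> X) (x y : realify X) : is_linear L ->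
  L (plus x y) = (plus (L x : realify X) (L y : realify X) : realify X).
Proof. intros HL. apply (linear_plus L HL). Qed.

Lemma linear_real_minus {X : CompleteNormedModule C_AbsRing} (L : X -> X) (x y : realify X) : is_linear L ->
  L (minus x y) = (minus (L x : realify X) (L y : realify X) : realify X).
Proof.
intros HL. replace (minus x y) with (plus x (scal (-1) y)) by module_eq.
rewrite (linear_real_plus _ _ _ HL), (linear_real_scal _ _ _ HL). module_eq_in (real_module X).
Qed.

Lemma norm_times_i (X : CompleteNormedModule C_AbsRing) (x : realify X) :
  norm (times_i X x) = norm x.
Proof.
pose proof (times_i_complex X) as HJ.
assert (E : forall y : realify X, rot (times_i X) (PI / 2) y = times_i X y).
{ intros y. unfold rot. rewrite cos_PI2, sin_PI2. module_eq. }
apply Rle_antisym.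
- rewrite <- E. apply (cs_isometry _ HJ).
- replace (norm x) with (norm (rot (times_i X) (- (PI / 2)) (times_i X x))).
  + apply (cs_isometry _ HJ).
  + rewrite <- (E x), (rot_rot _ _ HJ), Rplus_opp_l, rot_0. reflexivity.
Qed.

(** * The generator and its resolvent *)

Lemma op_norm_le {X : CompleteNormedModule C_AbsRing} (L : X -> X) (K : R) :
  is_linear L -> Rbar_le (op_norm L) K -> 0 <= K /\ forall x, norm (L x) <= K * norm x.
Proof.
intros HL HK.
assert (Hball : forall x, norm x <= 1 -> norm (L x) <= K).
{ intros x Hx. pose proof (proj1 (Lub_Rbar_correct (fun r => exists x, norm x <= 1 /\ r = norm (L x))) (norm (L x))) as H.
  assert (H' : Rbar_le (norm (L x)) (op_norm L)) by (apply H; exists x; split; [exact Hx|reflexivity]).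
  exact (Rbar_le_trans _ _ _ H' HK). }
assert (HK0 : 0 <= K).
{ eapply Rle_trans; [apply (norm_ge_0 (L zero))|]. apply Hball.
  eapply Rle_trans; [right; apply (norm_zero (K := C_AbsRing) (V := X))|lra]. }
split; [exact HK0|]. intros x.
destruct (Req_dec (norm x) 0) as [H0|H0].
- destruct (linear_norm _ HL) as [c [Hc Hcx]]. specialize (Hcx x). rewrite H0 in *. lra.
- assert (Hp : 0 < norm x) by (pose proof (norm_ge_0 x); lra).
  pose (y := scal (/ norm x)%R (x : realify X) : realify X).
  assert (Hy : @norm R_AbsRing (realify X) y = 1).
  { unfold y. rewrite norm_scal_eq, Rabs_pos_eq by (apply Rlt_le, Rinv_0_lt_compat, Hp).
    apply Rinv_l. exact H0. }
  replace (L x) with (scal (norm x : R) (L y : realify X) : realify X).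
  + apply Rle_trans with (Rabs (norm x) * norm (L y)).
    * right. apply (norm_scal_eq (realify X)).
    * rewrite (Rabs_pos_eq _ (Rlt_le _ _ Hp)), Rmult_comm.
      apply Rmult_le_compat_r; [lra|]. apply Hball. right. exact Hy.
  + rewrite <- linear_real_scal by exact HL. f_equal. unfold y.
    module_eq_with ltac:(try (field; exact H0)).
Qed.

Section Generator.
Variables (X : CompleteNormedModule C_AbsRing) (T : R -> X -> X) (A : operator X).
Hypothesis HT : is_C0_semigroup T.
Hypothesis HA : is_generator A T.

Lemma generator_value_unique x y y' : is_generator_value T x y -> is_generator_value T x y' -> y = y'.
Proof.
intros H H'. apply (filterlim_locally_unique (K := C_AbsRing) (V := X) (F := at_right 0) _ _ _ H H').
Qed.

Lemma generator_dom x y : is_generator_value T x y -> op_dom A x /\ op_map A x = y.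
Proof.
intros H. assert (Hd : op_dom A x) by (apply HA; exists y; exact H).
split; [exact Hd|]. apply (generator_value_unique x); [apply HA, Hd|exact H].
Qed.

(** For [x = R(i s) x'] the combination is [A x], which [resolvent_decay] needs to have
    in the domain. *)
Lemma generator_comb (x x' : realify X) (s : R) : op_dom A x -> op_dom A x' ->
  op_dom A (minus (scal s (times_i X x)) x') /\
  op_map A (minus (scal s (times_i X x)) x') =
    (minus (scal s (times_i X (op_map A x))) (op_map A x' : realify X) : realify X).
Proof.
intros Hx Hx'. apply generator_dom.
assert (HJ : is_linear (times_i X)) by apply (times_i_complex X).
apply (filterlim_ext_loc (F := at_right 0)
  (fun h : R => minus (scal s (times_i X (scal (/ h)%R (minus (T h x : realify X) x))))
                   (scal (/ h)%R (minus (T h x' : realify X) x')) : realify X)).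
- exists (mkposreal 1 Rlt_0_1). intros h _ Hh.
  assert (HL : is_linear (T h)) by (apply (C0_linear T HT); lra).
  change (minus (scal s (times_i X (scal (/ h)%R (minus (T h x : realify X) x))))
                   (scal (/ h)%R (minus (T h x' : realify X) x')) =
    (scal (/ h)%R (minus (T h (minus (scal s (times_i X x)) x') : realify X)
       (minus (scal s (times_i X x)) x')) : realify X)).
  rewrite (linear_real_minus _ _ _ HL), (linear_real_scal _ _ _ HL), (linear_times_i _ _ HL).
  rewrite (linear_scal _ HJ). unfold minus at 2. rewrite (linear_plus _ HJ).
  replace (times_i X (opp x)) with (opp (times_i X x)).
  2: { replace (opp x) with (scal (-1) x) by module_eq. rewrite (linear_scal _ HJ). module_eq. }
  module_eq.
- eapply (filterlim_comp_2
    (fun h : R => scal s (times_i X (scal (/ h)%R (minus (T h x : realify X) x))) : realify X)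
    (fun h : R => opp (scal (/ h)%R (minus (T h x' : realify X) x')) : realify X)
    (fun a b : realify X => plus a b)
    (G := locally (scal s (times_i X (op_map A x)) : realify X))
    (H := locally (opp (op_map A x' : realify X)))); [| |apply (filterlim_plus (K := R_AbsRing) (V := realify X))].
  + eapply filterlim_comp; [eapply filterlim_comp; [apply (proj2 HA x Hx)|]|].
    * apply (filterlim_scal_r (K := C_AbsRing) (V := X) Ci).
    * apply (filterlim_scal_r (K := R_AbsRing) (V := realify X)).
  + eapply filterlim_comp; [apply (proj2 HA x' Hx')|]. apply (filterlim_opp (K := C_AbsRing) (V := X)).
Qed.

Lemma generator_quotient x : op_dom A x -> forall eps : posreal, exists d : posreal, forall h, 0 < h < d ->
  @norm R_AbsRing (realify X)
    (minus (minus (T h x : realify X) (x : realify X)) (scal h (op_map A x : realify X)))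
    <= eps * h.
Proof.
intros Hx eps.
pose proof (proj2 HA x Hx) as H.
pose proof (proj1 (filterlim_locally_ball_norm (K := C_AbsRing) (U := X) _ _) H eps) as [d Hd].
exists d. intros h Hh.
assert (Hb : ball 0 d h) by (change (Rabs (h - 0) < d); rewrite Rminus_0_r, Rabs_pos_eq; lra).
specialize (Hd h Hb (proj1 Hh)). unfold ball_norm in Hd.
set (q := scal (RtoC (/ h)%R : C_AbsRing) (minus (T h x) x)) in Hd.
apply Rle_trans with (norm (scal (h : R) (minus (q : realify X) (op_map A x : realify X)))).
- right. apply f_equal. change (q : realify X) with (scal (/ h : R) (minus (T h x : realify X) (x : realify X)) : realify X).
  module_eq_with ltac:(try (field; lra)).
- eapply Rle_trans; [apply norm_scal_le|]. rewrite Rabs_pos_eq by lra.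
  rewrite Rmult_comm. apply Rmult_le_compat_r; [lra|]. left. exact Hd.
Qed.

Lemma resolvent_solves (s : R) y : resolvent_set A (Ci * s)%C ->
  op_dom A (op_inv (op_shift (Ci * s)%C A) y) /\
  minus (scal ((Ci * s)%C : C_AbsRing) (op_inv (op_shift (Ci * s)%C A) y)) (op_map A (op_inv (op_shift (Ci * s)%C A) y)) = y.
Proof.
intros [Hb _].
apply (iota_correct (fun x : X => op_dom (op_shift (Ci * s)%C A) x /\ op_map (op_shift (Ci * s)%C A) x = y)).
apply Hb.
Qed.

Lemma resolvent_unique (s : R) x y : resolvent_set A (Ci * s)%C ->
  op_dom A x -> minus (scal ((Ci * s)%C : C_AbsRing) x) (op_map A x) = y ->
  op_inv (op_shift (Ci * s)%C A) y = x.
Proof.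
intros Hs Hx E. destruct (proj1 Hs y) as [x0 [_ Hu]].
rewrite <- (Hu x (conj Hx E)). symmetry. apply Hu. apply (resolvent_solves s y Hs).
Qed.

Lemma inverse_solves y : resolvent_set A (Ci * 0)%C ->
  op_dom A (op_inv A y) /\ op_map A (op_inv A y) = y /\
  op_inv A y = opp (op_inv (op_shift (Ci * 0)%C A) y).
Proof.
intros H0.
assert (Hz : forall x : X, scal ((Ci * 0)%C : C_AbsRing) x = zero).
{ intros x. transitivity (scal (zero : C_AbsRing) x);
  [f_equal; apply Cmult_0_r|apply (scal_zero_l (K := C_AbsRing) (V := X))]. }
assert (Hval : forall x, op_map (op_shift (Ci * 0)%C A) x = opp (op_map A x)).
{ intros x. simpl. rewrite Hz. apply plus_zero_l. }
assert (HP : op_dom A (op_inv A y) /\ op_map A (op_inv A y) = y).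
{ apply (iota_correct (fun x : X => op_dom A x /\ op_map A x = y)).
  destruct (proj1 H0 (opp y)) as [x [[Hx E] Hu]]. rewrite Hval in E.
  exists x. split.
  - split; [exact Hx|]. rewrite <- (opp_opp (op_map A x)), E. apply (opp_opp (G := X)).
  - intros x' [Hx' E']. apply Hu. split; [exact Hx'|]. rewrite Hval, E'. reflexivity. }
destruct HP as [Hd E]. split; [exact Hd|]. split; [exact E|].
pose proof (resolvent_unique 0 (op_inv A y) (opp y) H0 Hd) as Hr.
rewrite <- Hr at 1.
- transitivity (op_inv (op_shift (Ci * 0)%C A) (scal (opp (one : C_AbsRing)) y)).
  + f_equal. symmetry. apply (scal_opp_one (K := C_AbsRing) (V := X)).
  + rewrite (linear_scal _ (proj2 H0)). apply (scal_opp_one (K := C_AbsRing) (V := X)).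
- rewrite Hz, E. apply plus_zero_l.
Qed.
End Generator.

(** On the range of [A^-1] the resolvent gains a factor [1 / |s|], because
    [i s R(i s) A^-1 x = R(i s) x + A^-1 x]; the mean over [[- R, R]] is then of order
    [m ln R / R] instead of [m]. *)
Lemma resolvent_decay {X : CompleteNormedModule C_AbsRing} (T : R -> X -> X) (A : operator X)
  (s a m : R) (x : X) :
  is_C0_semigroup T -> is_generator A T ->
  resolvent_set A (Ci * 0)%C -> resolvent_set A (Ci * s)%C ->
  norm (op_inv A x) <= a -> a <= m -> norm x <= 1 ->
  (forall v, norm (op_inv (op_shift (Ci * s)%C A) v) <= m * norm v) -> 
  norm (op_inv (op_shift (Ci * s)%C A) (op_inv A x)) <= (2 + a) * m / sqrt (s ^ 2 + 1).
Proof.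
intros HT HA H0 Hs Ha Ham Hx Hm.
destruct (inverse_solves X A x H0) as (Hz & EAz & _).
set (z := op_inv A x) in *.
set (Q := op_inv (op_shift (Ci * s)%C A)) in *.
destruct (resolvent_solves X A s z Hs) as [Hq Eq]. fold Q in Hq, Eq.
set (q := Q z) in *.
rewrite times_i_scal in Eq.
assert (Ha0 : 0 <= a) by (eapply Rle_trans; [apply (@norm_ge_0 C_AbsRing X z)|exact Ha]).
(* i s q - z = A q lies in the domain and is mapped to x by i s - A. *)
destruct (generator_comb X T A HT HA q z s Hq Hz) as [Hp Ep].
set (p := minus (scal s (times_i X q)) (z : realify X) : realify X) in *.
assert (EAq : op_map A q = p).
{ unfold p. rewrite <- Eq. module_eq_in (real_module X). }
assert (EQx : Q x = p).
{ apply (resolvent_unique X A s p x Hs Hp). rewrite times_i_scal, Ep, EAz, EAq.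
  module_eq_in (real_module X). }
assert (Hsq : Rabs s * norm (q : realify X) <= 2 * m).
{ apply Rle_trans with (norm (plus p (z : realify X))).
  - rewrite <- (norm_times_i X q). 
    apply Rle_trans with (norm (scal s (times_i X q) : realify X)); [|right; apply f_equal; unfold p; module_eq].
    right. symmetry. apply norm_scal_eq.
  - eapply Rle_trans; [apply norm_plus_le|].
    assert (norm p <= m).
    { rewrite <- EQx. eapply Rle_trans; [apply (Hm x)|]. 
      assert (0 <= m) by lra. apply Rle_trans with (m * 1); [|lra]. apply Rmult_le_compat_l; assumption. }
    assert (norm (z : realify X) <= a) by exact Ha. lra. }
assert (Hqn : norm (q : realify X) <= a * m).
{ eapply Rle_trans; [apply (Hm z)|]. rewrite Rmult_comm. apply Rmult_le_compat_r; [lra|exact Ha]. }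
assert (Hr : 0 < sqrt (s ^ 2 + 1)) by (apply sqrt_lt_R0; pose proof (pow2_ge_0 s); lra).
assert (Hr1 : sqrt (s ^ 2 + 1) <= Rabs s + 1).
{ pose proof (Rabs_pos s). rewrite <- (sqrt_pow2 (Rabs s + 1)) by lra. apply sqrt_le_1_alt.
  rewrite <- (pow2_abs s). nra. }
change (norm (q : realify X) <= (2 + a) * m / sqrt (s ^ 2 + 1)).
apply (Rmult_le_reg_r (sqrt (s ^ 2 + 1))); [exact Hr|].
replace ((2 + a) * m / sqrt (s ^ 2 + 1) * sqrt (s ^ 2 + 1)) with ((2 + a) * m) by (field; lra).
pose proof (norm_ge_0 (q : realify X)). nra.
Qed.

(** * The decay rate *)

Theorem theorem1p1
  (X : CompleteNormedModule C_AbsRing) (T : R -> X -> X) (A : operator X)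
  (M Mlog_inv : R -> R) (c : R)
  (HMpos : forall s, 0 <= s -> 0 < M s)
  (HMcont : continuous_nonneg M)
  (HMincr : nondecreasing_nonneg M)
  (HT : is_C0_semigroup T)
  (HTb : bounded_semigroup T)
  (HA : is_generator A T)
  (Hres : forall s : R, resolvent_set A (Ci * s)%C)
  (HM : forall s : R, Rbar_le (op_norm (op_inv (op_shift (Ci * s)%C A))) (M (Rabs s)))
  (Hinv : is_rc_right_inverse (Mlog M) Mlog_inv)
  (Hc : 0 < c < 1) :
  exists K : R, Rbar_locally p_infty (fun t : R =>
    Rbar_le (op_norm (fun x : X => T t (op_inv A x))) (K * (1 / Mlog_inv (c * t)))).
Proof.
destruct HTb as [K HTb].
assert (HTlin := C0_linear T HT).
assert (HTn : forall t x, 0 <= t -> norm (T t x) <= K * norm x)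
  by (intros t x Ht; apply (op_norm_le (T t) K (HTlin t Ht) (HTb t Ht))).
assert (HK : 0 <= K) by (apply (op_norm_le (T 0) K (HTlin 0 (Rle_refl 0)) (HTb 0 (Rle_refl 0)))).
assert (HQn : forall (s : R) (v : X), norm (op_inv (op_shift (Ci * s)%C A) v) <= M (Rabs s) * norm v)
  by (intros s; apply (op_norm_le _ _ (proj2 (Hres s)) (HM s))).
set (V := realify X).
set (M0 := M 0).
assert (HM0 : 0 < M0) by (apply HMpos; lra).
assert (Tplus : forall t (x y : V), 0 <= t -> T t (plus x y) = plus (T t x : V) (T t y : V))
  by (intros t x y Ht; apply (linear_real_plus (T t) x y (HTlin t Ht))).
assert (Tscal : forall t (k : R) (x : V), 0 <= t -> T t (scal k x) = scal k (T t x : V))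
  by (intros t k x Ht; apply (linear_real_scal (T t) k x (HTlin t Ht))).
assert (Tcont : forall (x : V) (eps : posreal), exists d : posreal, forall h, 0 <= h < d ->
  norm (minus (T h x : V) x) <= eps).
{ intros x eps.
  destruct (proj1 (filterlim_locally_ball_norm (K := C_AbsRing) (U := X) _ _) (C0_cont T HT x) eps) as [d Hd].
  exists d. intros h Hh. destruct (Req_dec h 0) as [->|Hh0].
  - rewrite (C0_zero T HT). apply Rle_trans with (norm (zero : V)); [right; apply f_equal; module_eq|].
    rewrite norm_zero_eq. apply Rlt_le, cond_pos.
  - left. apply (Hd h); [|lra]. change (Rabs (h - 0) < d). rewrite Rminus_0_r, Rabs_pos_eq; lra. }
set (U := reflected_orbit V T).
assert (HUc : forall z x, continuous (fun x => U x z) x)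
  by (intros z x; apply (continuous_reflected_orbit V T K HK Tplus Tscal HTn (C0_plus T HT) Tcont)).
assert (HUpos : forall t x, 0 <= t -> U t x = T t x) by (intros t x; apply (reflected_orbit_pos V T)).
assert (HUn : forall z x, 0 <= x -> norm (U x z) <= K * norm z)
  by (intros z x Hx; rewrite HUpos by exact Hx; apply HTn, Hx).
assert (HUd : forall z : V, op_dom A z -> forall t, 0 <= t -> is_derive (fun t => U t z) t (T t (op_map A z) : V)).
{ intros z Hz t Ht.
  apply (is_derive_reflected_orbit V T K HK Tplus Tscal HTn (C0_zero T HT) (C0_plus T HT) Tcont);
    [exact Ht|].
  apply (generator_quotient X T A HA z Hz). }
destruct (orbit_decay V (times_i X) (times_i_complex X) U K HK HUc HUn
  M0 ((K + 1) * (2 + M0)) c HM0) as (C & t0 & HC & Hcore);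
  [apply Rmult_le_pos; lra|exact Hc|].
destruct Hinv as [b Hinv].
(* Beyond [R1] the maximum in the definition of [Mlog] is [s * M s]. *)
set (R1 := Rmax 1 (exp 1 / M0)).
assert (HR1 : 1 <= R1 /\ exp 1 / M0 <= R1) by (split; [apply Rmax_l|apply Rmax_r]).
set (tau := Rmax b (Mlog M R1)).
exists C. exists (Rmax t0 (tau / c)). intros t Ht.
assert (Ht0 : t0 <= t) by (pose proof (Rmax_l t0 (tau / c)); lra).
assert (Hct : tau < c * t).
{ pose proof (Rmax_r t0 (tau / c)). apply (Rmult_lt_reg_r (/ c)); [apply Rinv_0_lt_compat; lra|].
  replace (c * t * / c) with t by (field; lra). unfold Rdiv in H. lra. }
assert (Hb : b < c * t) by (pose proof (Rmax_l b (Mlog M R1)); unfold tau in Hct; lra).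
assert (HML : Mlog M R1 < c * t) by (pose proof (Rmax_r b (Mlog M R1)); unfold tau in Hct; lra).
destruct (Hinv (c * t) Hb) as (HRp & HRe & _).
set (R0 := Mlog_inv (c * t)) in *.
assert (HR0 : R1 <= R0).
{ apply Rnot_lt_le. intros h. pose proof (Mlog_incr M HMpos HMincr R0 R1 HRp (Rlt_le _ _ h)). lra. }
set (m := M R0).
assert (Hm : M0 <= m) by (apply HMincr; lra).
assert (HRm : exp 1 <= R0 * m).
{ apply Rle_trans with (R0 * M0); [|apply Rmult_le_compat_l; lra].
  apply Rle_trans with (exp 1 / M0 * M0); [right; field; lra|]. apply Rmult_le_compat_r; lra. }
unfold Mlog in HRe. fold m in HRe. rewrite Rmax_right in HRe by exact HRm.
apply Lub_Rbar_correct. intros r (x & Hx & ->).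
simpl. set (z := op_inv A x).
destruct (inverse_solves X A x (Hres 0)) as (Hz & EAz & Ez).
fold z in Hz, EAz, Ez.
assert (Hzn : norm z <= M0).
{ rewrite Ez. eapply Rle_trans; [right; apply (norm_opp (K := C_AbsRing) (V := X))|].
  eapply Rle_trans; [apply HQn|]. rewrite Rabs_R0. fold M0.
  apply Rle_trans with (M0 * 1); [|lra]. apply Rmult_le_compat_l; lra. }
replace (C * (1 / R0)) with (C / R0) by (field; lra).
assert (Hlam : 1 <= ln (R0 * m)) by (rewrite <- (ln_exp 1); apply ln_le; [apply exp_pos|exact HRm]).
assert (Htp : 0 <= t).
{ apply Rnot_lt_le. intros h. assert (0 <= m * ln (R0 * m)) by (apply Rmult_le_pos; lra). nra. }
assert (HMs : forall s, Rabs s <= R0 -> M (Rabs s) <= m) by (intros s Hs; apply HMincr; [apply Rabs_pos|exact Hs]).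
assert (HQm : forall s, Rabs s <= R0 -> forall v : X, norm (op_inv (op_shift (Ci * s)%C A) v) <= m * norm v).
{ intros s Hs v. eapply Rle_trans; [apply HQn|]. apply Rmult_le_compat_r; [apply (@norm_ge_0 C_AbsRing X v)|apply HMs, Hs]. }
pose proof (HUd z Hz) as Hdz.
assert (Hxn : @norm R_AbsRing V (op_map A z) <= 1) by (rewrite EAz; exact Hx).
change (@norm R_AbsRing V (T t z) <= C / R0). rewrite <- HUpos by exact Htp.
apply (Hcore m R0 t z (fun s => op_inv (op_shift (Ci * s)%C A))); try assumption; try lra.
- intros s _ v u Hu. destruct (resolvent_solves X A s v (Hres s)) as [Hq Eq].
  set (q := op_inv (op_shift (Ci * s)%C A) v) in *.
  rewrite times_i_scal in Eq.
  assert (EAq : op_map A q = (minus (scal s (times_i X q)) (v : V) : V)).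
  { rewrite <- Eq. module_eq_in (real_module X). }
  rewrite !HUpos by exact Hu.
  evar_last; [apply HUd; assumption|].
  rewrite EAq, (linear_real_minus _ _ _ (HTlin u Hu)), (linear_real_scal _ _ _ (HTlin u Hu)),
      (linear_times_i _ _ (HTlin u Hu)). reflexivity.
- intros s Hs. eapply Rle_trans.
  + apply (resolvent_decay T A s M0 m x HT HA (Hres 0) (Hres s) Hzn Hm Hx (HQm s Hs)).
  + apply Rmult_le_compat_r.
    * apply Rlt_le, Rinv_0_lt_compat, sqrt_lt_R0. pose proof (pow2_ge_0 s). lra.
    * apply Rmult_le_compat_r; [lra|]. assert (0 <= K * (2 + M0)) by (apply Rmult_le_pos; lra). lra.
- intros u Hu. eapply Rle_trans; [apply HUn, Hu|].
  apply Rle_trans with (K * M0); [apply Rmult_le_compat_l; [exact HK|exact Hzn]|nra].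
- intros u v Hu Hv. eapply Rle_trans.
  + apply (orbit_lipschitz V T K HK Tplus Tscal HTn (C0_plus T HT) Tcont z (op_map A z) 1 Hxn Hdz u v Hu Hv).
  + apply Rmult_le_compat_r; [apply Rabs_pos|]. nra.
Qed.
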